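(* Let $n\ge 1$, $0<\alpha<n$ and $0<q<\infty$, and suppose that $\sigma$ is a weak $A_\infty$ weight on $\mathbf{R}^n$. Then there exist constants $c>1$ and $0<C<1$, depending only on $n$, $q$, $\alpha$ and the weak $A_\infty$ character of $\sigma$, such that for every nonnegative measure $\mu$ on $\mathbf{R}^n$, every $\lambda>0$ and every $0<\epsilon<1$, $$\bigl|\{x\in\mathbf{R}^n : (\mathbf{T}^q_\alpha(\mu)(x))^q>(1+c\epsilon)\lambda,\ (\mathbf{M}_\alpha(\mu)(x))^q\le\epsilon\lambda\}\bigr|_\sigma\le C\,\bigl|\{x\in\mathbf{R}^n : (\mathbf{T}^q_\alpha(\mu)(x))^q>\lambda\}\bigr|_\sigma .$$
   Context: For a nonnegative (Borel) measure $\mu$ on $\mathbf{R}^n$, $0<\alpha<n$ and $0<q<\infty$, the nonlinear potential is $$\mathbf{T}^q_\alpha(\mu)(x)=\Bigl(\int_0^\infty\Bigl(\frac{\mu(B(x,r))}{r^{n-\alpha}}\Bigr)^q\frac{dr}{r}\Bigr)^{1/q},$$ and the fractional maximal operator is $\mathbf{M}_\alpha(\mu)(x)=\sup_{r>0}\mu(B(x,r))\,r^{\alpha-n}$, where $B(x,r)$ is the ball with center $x$ and radius $r$. A nonnegative measurable function $\sigma$ on $\mathbf{R}^n$ is a weak $A_\infty$ weight if there exist constants $C_\sigma>0$ and $\theta>0$ such that for each cube $Q$ and each measurable set $E\subset Q$, $$\frac{|E|_\sigma}{|2Q|_\sigma}\le C_\sigma\Bigl(\frac{|E|}{|Q|}\Bigr)^\theta$$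 (i.e. $|E|_\sigma\le C_\sigma(|E|/|Q|)^\theta|2Q|_\sigma$), where $|E|$ is Lebesgue measure, $|E|_\sigma=\int_E\sigma\,dx$, and $2Q$ is the concentric double of $Q$. A constant depends on the weak $A_\infty$ character of $\sigma$ if it depends on $\theta$ and $C_\sigma$. *)

(* Defs.v *)
From HB Require Import structures.
From mathcomp Require Import all_boot all_order all_algebra.
From mathcomp Require Import all_classical all_reals all_analysis.

Set Implicit Arguments.
Unset Strict Implicit.
Unset Printing Implicit Defensive.
Import Order.TTheory GRing.Theory Num.Theory.
Local Open Scope classical_set_scope.
Local Open Scope ring_scope.
Local Open Scope ereal_scope.

(* R^n is represented by n-tuples; their canonical sigma-algebra is generated
   by the coordinate maps, i.e. it is the Borel sigma-algebra of R^n. *)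
Notation euclid R n := (n.-tuple (measurableTypeR R)).

Section lebesgue_n.
Variable R : realType.
Local Notation E n := (euclid R n).

Definition tuple_of_pair n (p : measurableTypeR R * E n) : E n.+1 :=
  [tuple of p.1 :: p.2].

Lemma measurable_tuple_of_pair n : measurable_fun setT (@tuple_of_pair n).
Proof. exact: measurable_cons. Qed.

Definition lebesgue_succ n (m : {sigma_finite_measure set (E n) -> \bar R}) :
    set (E n.+1) -> \bar R :=
  pushforward (@lebesgue_measure R \x m) (@tuple_of_pair n).

Section lebesgue_succ_measure.
Variables (n : nat) (m : {sigma_finite_measure set (E n) -> \bar R}).

Let lebesgue_succ0 : lebesgue_succ m set0 = 0.
Proof. by rewrite /lebesgue_succ /pushforward preimage_set0 measure0. Qed.

Let lebesgue_succ_ge0 A : 0 <= lebesgue_succ m A.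
Proof. exact: (measure_ge0 (@lebesgue_measure R \x m)). Qed.

Let lebesgue_succ_sigma_additive : semi_sigma_additive (lebesgue_succ m).
Proof.
move=> F mF tF mUF; rewrite /lebesgue_succ /pushforward preimage_bigcup.
have mpre A : measurable A -> measurable (@tuple_of_pair n @^-1` A).
  by move=> mA; rewrite -[X in measurable X]setTI; exact: measurable_tuple_of_pair.
apply: measure_semi_sigma_additive.
- by move=> i; exact: mpre.
- apply/trivIsetP => /= i j _ _ ij; rewrite -preimage_setI.
  by move/trivIsetP : tF => /(_ _ _ _ _ ij) ->//; rewrite preimage_set0.
- by rewrite -preimage_bigcup; exact: mpre.
Qed.

HB.instance Definition _ := isMeasure.Build _ _ _ (lebesgue_succ m)
  lebesgue_succ0 lebesgue_succ_ge0 lebesgue_succ_sigma_additive.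

Let lebesgue_succ_sigma_finite : sigma_finite setT (lebesgue_succ m).
Proof.
have [F FT Foo] : sigma_finite setT (@lebesgue_measure R \x m).
  have /sigma_finiteP[F [TF ndF Foo]] := sigma_finiteT (@lebesgue_measure R).
  have /sigma_finiteP[G [TG ndG Goo]] := sigma_finiteT m.
  exists (fun i => F i `*` G i).
    rewrite -setXTT TF TG predeqE => -[x y]; split.
      move=> [/= [i _ Fix] [k _ Gky]]; exists (maxn i k) => //; split.
      - by move: x Fix; exact/subsetPset/ndF/leq_maxl.
      - by move: y Gky; exact/subsetPset/ndG/leq_maxr.
    by move=> [i _ []/= ? ?]; split; exists i.
  move=> k; have [? ?] := Foo k; have [? ?] := Goo k.
  split; first exact: measurableX.
  by rewrite product_measure1E// lte_mul_pinfty// ge0_fin_numE.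
pose g (x : E n.+1) : measurableTypeR R * E n := (thead x, [tuple of behead x]).
have gK x : tuple_of_pair (g x) = x by rewrite /tuple_of_pair/= -tuple_eta.
have Kg p : g (tuple_of_pair p) = p.
  by case: p => a b; rewrite /g /tuple_of_pair theadE; congr pair; exact: val_inj.
have mg : measurable_fun setT g.
  apply: measurable_fun_pair; last exact: measurable_behead.
  exact: measurable_tnth.
exists (fun i => g @^-1` F i).
  by rewrite -preimage_bigcup -FT preimage_setT.
move=> i; have [mFi Fioo] := Foo i; split.
  by rewrite -[X in measurable X]setTI; exact: mg.
rewrite /lebesgue_succ /pushforward.
by rewrite -comp_preimage (_ : _ \o _ = id)//; apply/funext => p /=.
Qed.

HB.instance Definition _ := Measure_isSigmaFinite.Build _ _ _ (lebesgue_succ m)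
  lebesgue_succ_sigma_finite.

End lebesgue_succ_measure.

(* Lebesgue measure on the Borel sets, as an n-fold product. *)
Fixpoint borel_lebesgue n : {sigma_finite_measure set (E n) -> \bar R} :=
  match n with
  | 0%N => \d_([tuple] : E 0)
  | n'.+1 => lebesgue_succ (borel_lebesgue n')
  end.

(* R^n with the sigma-algebra of the Lebesgue measurable sets (convertible,
   as a type, to euclid R n). *)
Definition leb_euclid n := caratheodory_type (mu_ext (borel_lebesgue n)).
HB.instance Definition _ n := Measurable.on (leb_euclid n).

Definition lebesgue n : set (leb_euclid n) -> \bar R :=
  @completed_measure_extension _ _ _ (borel_lebesgue n).
HB.instance Definition _ n := Measure.on (@lebesgue n).

End lebesgue_n.
Arguments lebesgue {R n}.

Section potentials.
Variables (R : realType) (n : nat).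
Implicit Types (x : euclid R n) (r alpha q : R).

(* Tuples carry no canonical metric, so the Euclidean norm is written out. *)
Definition eball x r : set (euclid R n) :=
  [set y | (Num.sqrt (\sum_(i < n)
              ((tnth y i : R) - (tnth x i : R)) ^+ 2) < r)%R].

Definition T_pot alpha q (mu : {measure set (euclid R n) -> \bar R}) x
    : \bar R :=
  (\int[@lebesgue_measure R]_(r in `]0%R, +oo[)
     ((mu (eball x r) / (r `^ (n%:R - alpha))%:E) `^ q / r%:E)) `^ q^-1.

Definition M_frac alpha (mu : {measure set (euclid R n) -> \bar R}) x
    : \bar R :=
  ereal_sup [set mu (eball x r) * (r `^ (alpha - n%:R))%:E
            | r in `]0%R, +oo[].

End potentials.

Section weak_A_infty.
Variables (R : realType) (n : nat).

(* The closed cube with center a, side l and sides parallel to the axes. *)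
Definition cube (a : leb_euclid R n) (l : R) : set (leb_euclid R n) :=
  [set y : euclid R n | forall i : 'I_n,
     (`|(tnth y i : R) - (tnth (a : euclid R n) i : R)| <= l / 2)%R].

(* |A|_sigma *)
Definition weighted (sigma : leb_euclid R n -> R) (A : set (leb_euclid R n))
    : \bar R :=
  \int[lebesgue]_(x in A) (sigma x)%:E.

(* The ratio |A|/|Q| is well defined since |Q| is positive and finite; the
   condition is in product form, as |2Q|_sigma may be 0 or +oo. *)
Definition weak_A_infty (C_sigma theta : R) (sigma : leb_euclid R n -> R) :=
  [/\ (0 < C_sigma)%R, (0 < theta)%R,
      measurable_fun setT sigma,
      (forall x, 0 <= sigma x)%R &
      forall (a : leb_euclid R n) (l : R) (A : set (leb_euclid R n)),
        (0 < l)%R -> measurable A -> A `<=` cube a l ->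
        weighted sigma A <=
          C_sigma%:E * (lebesgue A / lebesgue (cube a l)) `^ theta
          * weighted sigma (cube a (2 * l)%R)].

End weak_A_infty.

(* Main.v *)
(** Let [Om = {T^q > lambda}], an open set, and let [Q] run over Whitney cubes
    of [Om] of side [l]. For [x] in [Q] in the good-lambda set pick [x0] outside
    [Om] at distance at most [rho], comparable to [l]. Since [B(x,r)] is
    contained in [B(x0,r+rho)], and the error of replacing [r^-b] by
    [(r+rho)^-b], where [b = q(n-alpha)+1], is controlled by [M(x)], the part
    [r > rho] of the integral [T(x)^q] of [mu(B(x,r))^q r^-b] is at most
    [lambda + C1 eps lambda]. So for large [c] the
    part [r <= rho] is a large multiple of [eps lambda], whence for some [j] the
    ball [B(x, rho/2^j)] has mass more than [H 2^(-j alpha/2)] times the largest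
    mass allowed by [M]. Counting grid cubes of side [rho/2^j], such [x] fill a
    set of Lebesgue measure [O(|Q|/H)], hence of sigma-measure at most
    [delta |2Q|_sigma] by the weak A_infty condition. The doubles [2Q] lie in
    [Om] with bounded overlap. If [Om] is the whole space, the weak A_infty
    condition forces the total mass of [sigma] to be 0 or infinite. *)

From HB Require Import structures.
Require Import Defs.
From mathcomp Require Import all_boot all_order all_algebra.
From mathcomp Require Import ring lra zify.
From mathcomp Require Import all_classical all_reals all_analysis measurable_realfun.
Set Implicit Arguments.
Unset Strict Implicit.
Unset Printing Implicit Defensive.
Import Order.TTheory GRing.Theory Num.Theory numFieldNormedType.Exports.
Import HBNNSimple.
Local Open Scope classical_set_scope.
Local Open Scope ring_scope.
Local Open Scope ereal_scope.

(** * Series and integrals: two preliminary bounds *)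

Lemma geometric_eseries_le (R : realType) (a z : R) :
  (0 <= a)%R -> (0 <= z < 1)%R ->
  \sum_(0 <= j <oo) (a * z ^+ j)%:E <= (a / (1 - z))%:E.
Proof.
move=> a0 /andP[z0 z1].
have nz : (`|z| < 1)%R by rewrite ger0_norm.
have cv := @cvg_geometric_series R a z nz.
have E : (fun n => \sum_(0 <= j < n) (a * z ^+ j)%:E)
         = EFin \o series (geometric a z).
  by apply/funext => n /=; rewrite /series/= -sumEFin.
rewrite E; have -> : limn (EFin \o series (geometric a z)) = (a / (1 - z))%:E.
  by apply/cvg_lim => //; apply: cvg_EFin => //; exact: nearW.
by [].
Qed.

(* No measurability is needed: the integral of a nonnegative function is a supremum
   over the simple functions below it. *)
Lemma le_integral_set (R : realType) d (T : measurableType d)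
    (mu : {measure set T -> \bar R}) (f : T -> \bar R) (A B : set T) :
  (forall x, 0 <= f x) -> A `<=` B ->
  \int[mu]_(x in A) f x <= \int[mu]_(x in B) f x.
Proof.
move=> f0 AB; rewrite !ge0_integralE//.
apply: ereal_sup_le => _ [h /= hA <-]; exists h => //= x.
apply: (le_trans (hA x)); rewrite !patchE.
case: ifPn => [/set_mem/AB xB|_]; first by rewrite mem_set.
by case: ifPn.
Qed.

(** * Families of sets with bounded overlap *)

Section countable_families.
Context (R : realType) (I : countType).

(** Turns a family over a countable type into a sequence, with the empty set at codes of no index of
    [D], so that sigma-additivity, which speaks of sequences, applies. *)
Let seq_of d (T : measurableType d) (D : set I) (F : I -> set T) (k : nat) :=
  if @pickle_inv I k is Some i then (if i \in D then F i else set0) else set0.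

Let bigcup_seq_of d (T : measurableType d) (D : set I) (F : I -> set T) :
  \bigcup_(i in D) F i = \bigcup_k seq_of D F k.
Proof.
apply/seteqP; split => [x [i Di Fx]|x [k _]].
  by exists (pickle i) => //; rewrite /seq_of pickleK_inv mem_set.
by rewrite /seq_of; case: pickle_inv => // i; case: ifPn => // /set_mem Di; exists i.
Qed.

Let measurable_seq_of d (T : measurableType d) (D : set I) (F : I -> set T) k :
  (forall i, D i -> measurable (F i)) -> measurable (seq_of D F k).
Proof.
by move=> mF; rewrite /seq_of; case: pickle_inv => // i; case: ifPn => // /set_mem/mF.
Qed.

Lemma countable_bigcup_measurable d (T : measurableType d) (D : set I)
    (F : I -> set T) :
  (forall i, D i -> measurable (F i)) -> measurable (\bigcup_(i in D) F i).
Proof.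
move=> mF; rewrite bigcup_seq_of; apply: bigcupT_measurable => k.
exact: measurable_seq_of.
Qed.

(** The [A i] may overlap, so only subadditivity is used for [nu1]; disjointness of the [B i] gives
    additivity for [nu2]. *)
Lemma disjoint_family_le d1 d2 (X : measurableType d1) (Y : measurableType d2)
    (nu1 : {measure set X -> \bar R}) (nu2 : {measure set Y -> \bar R})
    (D : set I) (A : I -> set X) (B : I -> set Y) (eta : R) : (0 <= eta)%R ->
  (forall i, D i -> measurable (A i)) -> (forall i, D i -> measurable (B i)) ->
  trivIset D B ->
  (forall i, D i -> nu1 (A i) <= eta%:E * nu2 (B i)) ->
  nu1 (\bigcup_(i in D) A i) <= eta%:E * nu2 (\bigcup_(i in D) B i).
Proof.
move=> eta0 mA mB tB AB; rewrite !bigcup_seq_of.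
rewrite [X in eta%:E * X]measure_semi_bigcup; last 3 first.
- by move=> k; exact: measurable_seq_of.
- move=> j k _ _; rewrite /seq_of => -[x []].
  have := @pickle_invK I j; have := @pickle_invK I k.
  case: (@pickle_inv I k) => //= i2 <-; case: (@pickle_inv I j) => //= i1 <-.
  case: ifPn => // /set_mem D1; case: ifPn => // /set_mem D2 x1 x2.
  by congr pickle; apply: (tB _ _ D1 D2); exists x.
- by apply: bigcupT_measurable => k; exact: measurable_seq_of.
rewrite -nneseriesZl//.
apply: (@le_trans _ _ (\sum_(0 <= k <oo) nu1 (seq_of D A k))).
  apply: measure_sigma_subadditive => //.
    by move=> k; exact: measurable_seq_of.
  by apply: bigcupT_measurable => k; exact: measurable_seq_of.
apply: lee_nneseries => // k _; rewrite /seq_of.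
case: pickle_inv => [i|]; last by rewrite !measure0 mule0.
by case: ifPn => [/set_mem/AB//|]; rewrite !measure0 mule0.
Qed.

(* Bounded overlap of the [B i] is expressed by a finite coloring whose color classes
   are disjoint families. *)
Lemma colored_family_le d1 d2 (X : measurableType d1) (Y : measurableType d2)
    (nu1 : {measure set X -> \bar R}) (nu2 : {measure set Y -> \bar R})
    (C : finType) (col : I -> C) (D : set I) (A : I -> set X) (B : I -> set Y)
    (U : set Y) (eta : R) : (0 <= eta)%R ->
  (forall i, D i -> measurable (A i)) -> (forall i, D i -> measurable (B i)) ->
  (forall i j, D i -> D j -> col i = col j -> B i `&` B j !=set0 -> i = j) ->
  (forall i, D i -> nu1 (A i) <= eta%:E * nu2 (B i)) ->
  measurable U -> (forall i, D i -> B i `<=` U) ->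
  nu1 (\bigcup_(i in D) A i) <= (#|C|%:R * eta)%:E * nu2 U.
Proof.
move=> eta0 mA mB tB AB mU BU.
pose F (c : C) := \bigcup_(i in D `&` col @^-1` [set c]) A i.
have mF c : measurable (F c) by apply: countable_bigcup_measurable => i [/mA].
have FU c : nu1 (F c) <= eta%:E * nu2 U.
  apply: (@le_trans _ _ (eta%:E * nu2 (\bigcup_(i in D `&` col @^-1` [set c]) B i))).
    apply: disjoint_family_le => //.
    - by move=> i [/mA].
    - by move=> i [/mB].
    - by move=> i j [Di /= ci] [Dj /= cj]; apply: tB => //; rewrite ci cj.
    - by move=> i [/AB].
  apply: lee_wpmul2l; first by rewrite lee_fin.
  apply: le_measure; rewrite ?inE//.
    by apply: countable_bigcup_measurable => i [/mB].
  by move=> x [i [/BU BiU _] /BiU].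
have -> : \bigcup_(i in D) A i = \big[setU/set0]_(c <- enum C) F c.
  apply/seteqP; split => [x [i Di Ax]|x].
    by rewrite -bigcup_seq; exists (col i) => /=; [rewrite mem_enum|exists i].
  by rewrite -bigcup_seq => -[c _ [i [Di _] Ax]]; exists i.
(* Each color class costs at most [eta * nu2 U]; the colors are added one at a time. *)
rewrite cardE; elim: (enum C) => [|c s IH].
  by rewrite big_nil measure0 mul0r mul0e.
rewrite big_cons/= -natr1 mulrDl mul1r EFinD.
rewrite ge0_muleDl ?lee_fin ?mulr_ge0// addeC.
apply: (@le_trans _ _ (nu1 (F c) + nu1 (\big[setU/set0]_(b <- s) F b))).
  by apply: measureU2 => //; exact: bigsetU_measurable.
exact: leeD.
Qed.

End countable_families.

(** * Balls and cubes *)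

Section euclidean_space.
Context (R : realType).
Local Notation E n := (euclid R n).

Definition tcoord n (x : E n) (i : 'I_n) : R := tnth x i.

Lemma measurable_coord n (i : 'I_n) : measurable_fun setT (fun x : E n => tcoord x i).
Proof. exact: measurable_tnth. Qed.

(** Here [l] is the half-side, whereas in [cube a l] it is the side. *)
Definition box n (a : E n) (l : R) : set (E n) :=
  [set y | forall i, (`|tcoord y i - tcoord a i| <= l)%R].

Lemma measurable_box n (a : E n) l : measurable (box a l).
Proof.
rewrite (_ : box a l = \bigcap_(i in [set` predT])
    ((fun x : E n => tcoord x i) @^-1` `[(tcoord a i - l)%R, (tcoord a i + l)%R])).
  apply: fin_bigcap_measurable => // i _.
  by rewrite -[X in measurable X]setTI; exact: measurable_coord.
apply/seteqP; split => [y ay i _|y ay i].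
  by move: (ay i); rewrite /= in_itv/= ler_distl.
by move: (ay i isT); rewrite /= in_itv/= ler_distl.
Qed.

Definition eucl_dist n (x y : E n) : R :=
  Num.sqrt (\sum_(i < n) (tcoord y i - tcoord x i) ^+ 2).

Lemma measurable_eucl_dist n (x : E n) : measurable_fun setT (eucl_dist x).
Proof.
rewrite (_ : eucl_dist x = (fun s => (s `^ 2^-1)%R) \o
    (fun y : E n => \sum_(i < n) (tcoord y i - tcoord x i) ^+ 2)%R).
  apply: measurableT_comp; first exact: measurable_powR.
  apply: measurable_sum => i; apply: measurable_funX.
  by apply: measurable_funB => //; exact: measurable_coord.
by apply/funext => y /=; rewrite powR12_sqrt// sumr_ge0// => i _; exact: sqr_ge0.
Qed.

Lemma eucl_dist_ge0 n (x y : E n) : (0 <= eucl_dist x y)%R.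
Proof. exact: sqrtr_ge0. Qed.

Lemma eucl_distC n (x y : E n) : eucl_dist x y = eucl_dist y x.
Proof. by rewrite /eucl_dist; congr Num.sqrt; apply: eq_bigr => i _; ring. Qed.

Lemma sqr_eucl_dist n (x y : E n) :
  (eucl_dist x y ^+ 2 = \sum_(i < n) (tcoord y i - tcoord x i) ^+ 2)%R.
Proof. by rewrite sqr_sqrtr// sumr_ge0// => i _; exact: sqr_ge0. Qed.

Lemma ler_coord_eucl_dist n (x y : E n) i : (`|tcoord y i - tcoord x i| <= eucl_dist x y)%R.
Proof.
rewrite -ler_sqr ?nnegrE ?eucl_dist_ge0// sqr_eucl_dist real_normK ?num_real//.
by rewrite (bigD1 i)//= lerDl sumr_ge0// => j _; exact: sqr_ge0.
Qed.

(** In place of Cauchy-Schwarz: with [A] and [B] the two distances on the right, [(a + b)^2 <= (1 +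
    B/A) a^2 + (1 + A/B) b^2] in each coordinate, and the sum over the coordinates is [(A + B)^2].
    Zero distances are treated first, to allow the divisions. *)
Lemma eucl_dist_triangle n (x y z : E n) : (eucl_dist x z <= eucl_dist x y + eucl_dist y z)%R.
Proof.
have [/eqP xy0|xy0] := boolP (eucl_dist x y == 0)%R.
  rewrite xy0 add0r /eucl_dist le_eqVlt; apply/orP; left; apply/eqP; congr Num.sqrt.
  apply: eq_bigr => i _; congr (_ ^+ 2)%R.
  by have := ler_coord_eucl_dist x y i; rewrite xy0 normr_le0 subr_eq0 => /eqP ->.
have [/eqP yz0|yz0] := boolP (eucl_dist y z == 0)%R.
  rewrite yz0 addr0 /eucl_dist le_eqVlt; apply/orP; left; apply/eqP; congr Num.sqrt.
  apply: eq_bigr => i _; congr (_ ^+ 2)%R.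
  by have := ler_coord_eucl_dist y z i; rewrite yz0 normr_le0 subr_eq0 => /eqP ->.
have A0 : (0 < eucl_dist x y)%R by rewrite lt0r xy0 eucl_dist_ge0.
have B0 : (0 < eucl_dist y z)%R by rewrite lt0r yz0 eucl_dist_ge0.
rewrite -ler_sqr ?nnegrE ?eucl_dist_ge0 ?addr_ge0 ?eucl_dist_ge0//.
rewrite {1}sqr_eucl_dist.
set A := eucl_dist x y in A0 *; set B := eucl_dist y z in B0 *.
apply: (@le_trans _ _ (\sum_(i < n) ((1 + B / A) * (tcoord y i - tcoord x i) ^+ 2
   + (1 + A / B) * (tcoord z i - tcoord y i) ^+ 2)))%R.
  apply: ler_sum => i _.
  set a := (tcoord y i - tcoord x i)%R; set b := (tcoord z i - tcoord y i)%R.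
  have -> : (tcoord z i - tcoord x i = a + b)%R by rewrite /a /b; ring.
  rewrite -subr_ge0.
  have -> : ((1 + B / A) * a ^+ 2 + (1 + A / B) * b ^+ 2 - (a + b) ^+ 2
             = (A * B)^-1 * (B * a - A * b) ^+ 2)%R.
    by field; rewrite !gt_eqF.
  by rewrite mulr_ge0 ?sqr_ge0// invr_ge0 mulr_ge0// ltW.
rewrite big_split/= -!mulr_sumr -!sqr_eucl_dist -/A -/B le_eqVlt.
by apply/orP; left; apply/eqP; field; rewrite !gt_eqF.
Qed.

Lemma eucl_dist_le_sup n (x y : E n) (r : R) : (0 < n)%N ->
  (forall i, `|tcoord y i - tcoord x i| <= r)%R -> (eucl_dist x y <= n%:R * r)%R.
Proof.
move=> n0 H.
have r0 : (0 <= r)%R by apply: le_trans (H (Ordinal n0)).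
rewrite -ler_sqr ?nnegrE ?eucl_dist_ge0 ?mulr_ge0// sqr_eucl_dist.
apply: (@le_trans _ _ (\sum_(i < n) r ^+ 2)%R).
  apply: ler_sum => i _.
  by rewrite -[leLHS]real_normK ?num_real// ler_sqr ?nnegrE.
rewrite sumr_const card_ord -[leLHS]mulr_natl exprMn ler_wpM2r ?sqr_ge0//.
by rewrite expr2 ler_peMr// ler1n.
Qed.

Lemma eucl_distxx n (x : E n) : eucl_dist x x = 0%R.
Proof.
by rewrite /eucl_dist big1 ?sqrtr0// => i _; rewrite subrr expr0n.
Qed.

Lemma measurable_eball n (a : E n) r : measurable (eball a r).
Proof.
rewrite (_ : eball a r = eucl_dist a @^-1` `]-oo, r[).
  by rewrite -[X in measurable X]setTI; exact: measurable_eucl_dist.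
by apply/seteqP; split => y; rewrite /= in_itv.
Qed.

Lemma sub_eball n (x y : E n) (r s : R) : (eucl_dist x y + r <= s)%R ->
  eball x r `<=` eball y s.
Proof.
move=> xy z zx; have {}zx : (eucl_dist x z < r)%R by [].
rewrite /eball/= -/(eucl_dist y z); apply: le_lt_trans (eucl_dist_triangle y x z) _.
by rewrite eucl_distC (lt_le_trans _ xy)// ltrD2l.
Qed.

(** Induction on the dimension: a box is the product of an interval and a box in the remaining
    coordinates. *)
Lemma borel_lebesgue_box n (a : E n) (l : R) : (0 <= l)%R ->
  borel_lebesgue R n (box a l) = ((2 * l) ^+ n)%:E.
Proof.
move=> l0; elim: n a => [|n IH] a.
  rewrite expr0 /= diracE mem_set//.
  by case.
rewrite /= /lebesgue_succ /pushforward.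
have -> : @tuple_of_pair R n @^-1` box a l =
   `[(thead a - l)%R, (thead a + l)%R] `*` box [tuple of behead a] l.
  apply/seteqP; split => [[x y] /= H|[x y] /= [H1 H2] i].
  - split.
      by move: (H ord0); rewrite ler_distl /tcoord /thead !(tnth_nth 0%R)/=.
    move=> i; move: (H (lift ord0 i)).
    by rewrite /tcoord !(tnth_nth 0%R)/= nth_behead.
  - have [->|] := eqVneq i ord0; last first.
      move=> i0; have [j ->] : exists j, i = lift ord0 j.
        by case: (unliftP ord0 i) i0 => [j ->|->]; [exists j|rewrite eqxx].
      by move: (H2 j); rewrite /tcoord !(tnth_nth 0%R)/= nth_behead.
    by move: H1; rewrite ler_distl /tcoord /thead !(tnth_nth 0%R)/=.
rewrite product_measure1E//; last exact: measurable_box.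
rewrite IH [X in X * _](_ : _ = lebesgue_measure `[(thead a - l)%R, (thead a + l)%R])//.
rewrite lebesgue_measure_itv/= lte_fin.
case: ifPn => [_|].
  by rewrite -EFinD -EFinM exprS; congr EFin; congr (_ * _)%R; ring.
rewrite -leNgt => ll; have -> : l = 0%R by lra.
by rewrite mulr0 exprS mul0r mul0e.
Qed.

End euclidean_space.

(** * One-dimensional integrals *)

(** Raise the exponent to an integer [N >= b]; the convex function [(1 + v)^N] lies below its chord
    on [[0, 1]], of slope [2^N - 1]. This makes the cost of moving the center of balls linear in the
    displacement. *)
Lemma powR1D_le (R : realType) (b : R) :
  exists N : nat, forall v : R, (0 <= v <= 1 -> (1 + v) `^ b <= 1 + 2 ^+ N * v)%R.
Proof.
exists (Num.truncn b).+1 => v /andP[v0 v1].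
have bN : (b <= (Num.truncn b).+1%:R)%R by apply/ltW/Num.Theory.truncnS_gt.
apply: (@le_trans _ _ ((1 + v) ^+ (Num.truncn b).+1)%R).
  by rewrite -powR_mulrn ?addr_ge0// ler_powR// lerDl.
have {bN} : forall N, ((1 + v) ^+ N <= 1 + (2 ^+ N - 1) * v)%R.
  elim=> [|N IH]; first by rewrite !expr0 subrr mul0r addr0.
  rewrite exprSr; apply: le_trans (ler_wpM2r _ IH) _; first by rewrite addr_ge0.
  rewrite -subr_ge0 exprS.
  have -> : (1 + (2 * 2 ^+ N - 1) * v - (1 + (2 ^+ N - 1) * v) * (1 + v)
            = (2 ^+ N - 1) * (v * (1 - v)))%R by ring.
  rewrite mulr_ge0// ?subr_ge0 ?exprn_ege1 ?ler1n// mulr_ge0// subr_ge0//.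
move=> /(_ (Num.truncn b).+1) /le_trans; apply.
by rewrite lerD2l ler_wpM2r// gerBl.
Qed.

(** Superlevel sets of a monotone function are intervals. This yields the measurability of
    [r |-> mu (eball x r)]. *)
Lemma nondecreasing_emeasurable (R : realType) (D : set R) (f : R -> \bar R) :
  measurable D -> {homo f : x y / (x <= y)%R >-> x <= y} -> measurable_fun D f.
Proof.
move=> mD nf.
apply: (measurability (@ErealGenOInfty.G R)) => [|/= _ [_] [r] -> <-].
  exact: ErealGenOInfty.measurableE.
apply: measurableI => //; apply: is_interval_measurable => s t/=.
rewrite !in_itv/= !andbT => fs ft u /andP[su ut].
by rewrite in_itv/= andbT (lt_le_trans fs)// nf.
Qed.

Section translation.
Context (R : realType).
Local Notation leb := (@lebesgue_measure R).

Let shift_ (d : R) (t : measurableTypeR R) : measurableTypeR R := (t + d)%R.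

Let measurable_shift d : measurable_fun setT (shift_ d).
Proof. exact: measurable_funD. Qed.

(** By uniqueness of Lebesgue measure, it suffices that translation preserves the lengths of
    half-open intervals. *)
Let pushforward_shift d : forall A, measurable A ->
  pushforward leb (shift_ d) A = leb A.
Proof.
pose mphi := isMeasurableFun.Build _ _ _ _ _ (measurable_shift d).
pose phi : {mfun measurableTypeR R >-> measurableTypeR R} := HB.pack (shift_ d) mphi.
move=> A mA.
rewrite (@lebesgue_measure_unique R (pushforward leb phi))//.
move=> _ [[a b] _ <-] /=; rewrite /pushforward/=.
rewrite (_ : shift_ d @^-1` _ = `](a - d)%R, (b - d)%R]%classic).
  rewrite !lebesgue_measure_itv/= !lte_fin ltrD2r; case: ifPn => // _.
  by rewrite -!EFinB; congr EFin; ring.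
apply/seteqP; split => t; rewrite /= /shift_ !in_itv/=; lra.
Qed.

Lemma ge0_integral_itvoy_shift (f : R -> \bar R) (a d : R) :
  measurable_fun `](a + d)%R, +oo[%classic f -> (forall t, 0 <= f t) ->
  \int[leb]_(t in `]a, +oo[) f (t + d)%R = \int[leb]_(s in `](a + d)%R, +oo[) f s.
Proof.
move=> mf f0.
rewrite [RHS](eq_measure_integral (pushforward leb (shift_ d))); last first.
  by move=> A mA _; exact/esym/pushforward_shift.
rewrite (ge0_integral_pushforward (measurable_shift d))//.
rewrite (_ : shift_ d @^-1` _ = `]a, +oo[%classic)//.
by apply/seteqP; split => t; rewrite /= /shift_ !in_itv/=; lra.
Qed.

End translation.

Lemma inv_sqr_continuous (R : realType) (x : R) : (0 < x)%R ->
  {for x, continuous (fun y : R => (y ^- 2)%R)}.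
Proof.
move=> x0; apply: (@continuous_comp _ _ _ (fun y : R => y ^+ 2)%R (@GRing.inv R)).
  exact: exprn_continuous.
by apply: inv_continuous; rewrite gt_eqF// exprn_gt0.
Qed.

Lemma measurable_inv_sqr (R : realType) (a : R) : (0 < a)%R ->
  measurable_fun `]a, +oo[%classic (fun s : R => (s ^- 2)%:E).
Proof.
move=> a0; apply/measurable_EFinP; apply: open_continuous_measurable_fun => //.
move=> x /set_mem /=; rewrite in_itv/= andbT => ax.
exact/inv_sqr_continuous/(lt_trans a0).
Qed.

(** Fundamental theorem of calculus with the primitive [- s^-1], which vanishes at infinity. *)
Lemma integral_inv_sqr (R : realType) (a : R) : (0 < a)%R ->
  \int[@lebesgue_measure R]_(s in `]a, +oo[) (s ^- 2)%:E = (a^-1)%:E.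
Proof.
move=> a0.
have cV (x : R) : (0 < x)%R -> {for x, continuous (@GRing.inv R)}.
  by move=> x0; apply: inv_continuous; rewrite gt_eqF.
have dV (x : R) : (0 < x)%R -> is_derive x 1%R (fun y : R => - y^-1)%R (x ^- 2)%R.
  move=> x0; rewrite -[X in is_derive _ _ _ X]opprK; apply: is_deriveN.
  rewrite (_ : (- x ^- 2 = - x ^- 2 *: 1)%R); last by rewrite /GRing.scale/= mulr1.
  by apply: (@is_deriveV R id); rewrite gt_eqF.
rewrite integral_itv_obnd_cbnd; last exact: measurable_inv_sqr.
rewrite (@ge0_continuous_FTC2y R (fun s => s ^- 2)%R (fun s => - s^-1)%R a 0%R).
- by rewrite sub0e -EFinN opprK.
- by move=> x ax; rewrite invr_ge0 sqr_ge0.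
- apply: continuous_in_subspaceT => x /set_mem /=; rewrite in_itv/= andbT => ax.
  exact/inv_sqr_continuous/(lt_le_trans a0).
- rewrite -oppr0; apply: cvgN; apply/gtr0_cvgV0; last exact: cvg_id.
  by near=> x; near: x; exact: nbhs_pinfty_gt.
- by move=> x ax; apply: ex_derive; apply: dV; exact: lt_trans ax.
- apply: cvg_at_right_filter; apply: cvgN; exact: cV.
- move=> x; rewrite in_itv/= andbT => ax; rewrite derive1E.
  by apply: derive_val; apply: dV; exact: lt_trans ax.
Unshelve. all: by end_near. Qed.

(** The interval is cut into the dyadic shells [I j], of length [rho * 2^-1 ^+ j.+1], on each of
    which [f] is bounded by a constant. *)
Lemma dyadic_integral_le (R : realType) (f : R -> \bar R) (rho : R) (c : nat -> R) :
  (0 < rho)%R -> measurable_fun `]0%R, rho]%classic f -> (forall t, 0 <= f t) ->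
  (forall j t, (rho * 2^-1 ^+ j.+1 < t <= rho * 2^-1 ^+ j)%R -> f t <= (c j)%:E) ->
  \int[@lebesgue_measure R]_(t in `]0%R, rho]) f t
    <= \sum_(0 <= j <oo) (c j * (rho * 2^-1 ^+ j.+1))%:E.
Proof.
move=> rho0 mf f0 fc.
pose I (j : nat) : set R := `](rho * 2^-1 ^+ j.+1)%R, (rho * 2^-1 ^+ j)%R]%classic.
have s_gt0 j : (0 < rho * 2^-1 ^+ j)%R by rewrite mulr_gt0// exprn_gt0.
have s_le j k : (j <= k)%N -> (rho * 2^-1 ^+ k <= rho * 2^-1 ^+ j)%R.
  by move=> jk; rewrite ler_pM2l// ler_wiXn2l// invf_le1// ler1n.
have sI j : I j `<=` `]0%R, rho]%classic.
  move=> t; rewrite /I /= !in_itv/= => /andP[t1 t2].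
  rewrite (lt_trans _ t1)//= (le_trans t2)//.
  by have := s_le 0%N j isT; rewrite expr0 mulr1.
have UI : `]0%R, rho]%classic = \bigcup_j I j.
  apply/seteqP; split => [t|t [j _ /sI//]].
  rewrite /= in_itv/= => /andP[t0 trho].
  have [m mt] : exists m, (rho * 2^-1 ^+ m < t)%R.
    exists (Num.truncn (rho / t)).+1; rewrite exprVn ltr_pdivrMr ?exprn_gt0//.
    rewrite mulrC -ltr_pdivrMr//.
    apply: (lt_le_trans (Num.Theory.truncnS_gt (rho / t)%R)).
    by rewrite -natrX ler_nat ltnW// ltn_expl.
  (* The least [k] with [rho / 2^k < t] is not 0, as [t <= rho]; hence [t] lies in the shell of
     index [k - 1]. *)
  have [k kt kmin] := ex_minnP (ex_intro (fun m => rho * 2^-1 ^+ m < t)%R m mt).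
  case: k kt kmin => [|k] kt kmin.
    by move: kt; rewrite expr0 mulr1 ltNge trho.
  exists k => //; rewrite /I /= in_itv/= kt/= leNgt; apply/negP => /kmin.
  by rewrite ltnn.
have tI : trivIset setT I.
  have aux j k t : I j t -> I k t -> (k <= j)%N.
    rewrite /I /= !in_itv/= => /andP[t1 _] /andP[_ t2].
    rewrite leqNgt; apply/negP => /s_le; rewrite leNgt => /negP; apply.
    exact: (lt_le_trans t1 t2).
  move=> j k _ _ [t [jt kt]]; apply/eqP; rewrite eqn_leq.
  by rewrite (aux _ _ _ kt jt) (aux _ _ _ jt kt).
rewrite UI ge0_integral_bigcup//; last 2 first.
- by move=> j; exact: measurable_itv.
- by rewrite -UI.
apply: lee_nneseries => [j _ _|j _]; first exact: integral_ge0.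
apply: (@le_trans _ _ (\int[@lebesgue_measure R]_(t in I j) (c j)%:E)).
  apply: ge0_le_integral => //.
  - exact: measurable_itv.
  - by apply: measurable_funS mf => //; exact: measurable_itv.
  - by move=> t; rewrite /I /= in_itv/=; exact: fc.
rewrite integral_cst; last exact: measurable_itv.
rewrite [X in _ * X](_ : _ = lebesgue_measure (I j))// /I.
rewrite lebesgue_measure_itv/= lte_fin ltr_pM2l// ltr_iXn2l ?invf_lt1 ?ltr1n//.
rewrite ltnS leqnn -EFinB -EFinM lee_fin exprS.
by rewrite le_eqVlt; apply/orP; left; apply/eqP; field.
Qed.

(** * The nonlinear potential *)

Lemma powR_invl (R : realType) (x b : R) : (0 <= x)%R -> (x^-1 `^ b = x `^ (- b))%R.
Proof. by move=> x0; rewrite -powR_inv1// -powRrM mulN1r. Qed.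

Lemma powR_itv01 (R : realType) (x p : R) :
  (0 < x < 1)%R -> (0 < p)%R -> (0 < x `^ p < 1)%R.
Proof.
move=> /andP[x0 x1] p0; rewrite powR_gt0//=.
rewrite -[X in (_ < X)%R](congr1 (@^~ p) (@powR1 R))/=.
by rewrite gt0_ltr_powR ?nnegrE// ltW.
Qed.

(** This number is the ratio of the geometric series over scales. Half of the exponent [alpha] makes
    the local integral converge, the other half makes the measures of the exceptional sets
    summable. *)
Lemma half_powR_itv (R : realType) (alpha : R) :
  (0 < alpha)%R -> (0 < 2^-1 `^ (alpha / 2) < 1)%R.
Proof.
move=> alpha0; apply: powR_itv01; last by rewrite divr_gt0.
by rewrite invr_gt0 ltr0n/= invf_lt1 ?ltr1n.
Qed.

Lemma le_poweR (R : realType) (q : R) (x y : \bar R) :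
  (0 <= q)%R -> 0 <= x -> x <= y -> x `^ q <= y `^ q.
Proof.
move=> q0 x0 xy; apply: gt0_ler_poweR => //; rewrite in_itv/= leey andbT//.
exact: le_trans xy.
Qed.

Section potential.
Context (R : realType) (n : nat) (alpha q : R).
Hypotheses (alpha_gt0 : (0 < alpha)%R) (alpha_ltn : (alpha < n%:R)%R) (q_gt0 : (0 < q)%R).
Local Notation E := (euclid R n).
Local Notation leb := (@lebesgue_measure R).
Local Notation gam := (n%:R - alpha)%R.
Local Notation b := (q * gam + 1)%R.

Let gam_gt0 : (0 < gam)%R. Proof. by rewrite subr_gt0. Qed.
Let b_gt0 : (0 < b)%R. Proof. by rewrite addr_gt0// mulr_gt0. Qed.

(* For [r > 0], the integrand of [T_pot] with the powers of [r] collected. *)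
Definition density (mu : {measure set E -> \bar R}) (x : E) (r : R) : \bar R :=
  mu (eball x r) `^ q * (r `^ (- b))%:E.

Lemma density_ge0 mu x r : 0 <= density mu x r.
Proof. by rewrite mule_ge0 ?poweR_ge0// lee_fin powR_ge0. Qed.

Lemma le_mu_eball (mu : {measure set E -> \bar R}) x y r s :
  (eucl_dist x y + r <= s)%R -> mu (eball x r) <= mu (eball y s).
Proof.
move=> xy; apply: le_measure; rewrite ?inE; [exact: measurable_eball..|].
exact: sub_eball.
Qed.

Lemma measurable_shifted_density (mu : {measure set E -> \bar R}) x d (D : set R) :
  measurable D ->
  measurable_fun D (fun s => mu (eball x s) `^ q * ((s - d) `^ (- b))%:E).
Proof.
move=> mD; apply: emeasurable_funM.
  apply: nondecreasing_emeasurable => // r s rs.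
  by apply: le_poweR => //; [exact: ltW|apply: le_mu_eball; rewrite eucl_distxx add0r].
apply/measurable_EFinP; apply: measurable_funTS.
apply: (@measurableT_comp _ _ _ _ _ _ (fun r => r `^ (- b))%R).
  exact: measurable_powR.
exact: measurable_funB.
Qed.

Lemma measurable_density mu x (D : set R) : measurable D ->
  measurable_fun D (density mu x).
Proof.
move=> mD; rewrite (_ : density mu x =
    fun s => mu (eball x s) `^ q * ((s - 0) `^ (- b))%:E).
  exact: measurable_shifted_density.
by apply/funext => s; rewrite subr0.
Qed.

Lemma T_potE mu (x : E) :
  T_pot alpha q mu x `^ q = \int[leb]_(r in `]0%R, +oo[) density mu x r.
Proof.
rewrite /T_pot -poweRrM mulVf ?gt_eqF// poweRe1; last first.
  apply: integral_ge0 => r /=; rewrite in_itv/= andbT => r0.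
  by rewrite mule_ge0 ?poweR_ge0// inver gt_eqF// lee_fin invr_ge0 ltW.
apply: eq_integral => r /set_mem; rewrite /= in_itv/= andbT => r0.
rewrite /density inver gt_eqF ?powR_gt0// poweRM//; last first.
  by rewrite lee_fin invr_ge0 powR_ge0.
rewrite inver gt_eqF// -muleA; congr (_ * _); rewrite poweR_EFin -EFinM; congr EFin.
rewrite powR_invl ?powR_ge0// -powRrM -[X in (_ * X)%R]powR_inv1 ?ltW//.
rewrite -powRD; last by rewrite (gt_eqF r0) implybT.
by congr (powR _ _); ring.
Qed.

(** The ball [B(x, r)] lies in [B(y, r + d)]; then substitute [s = r + d]. *)
Lemma T_pot_le_shift mu x y a d : (0 < a)%R -> (eucl_dist x y <= d)%R ->
  \int[leb]_(r in `]a, +oo[) density mu x r <=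
  \int[leb]_(s in `](a + d)%R, +oo[) (mu (eball y s) `^ q * ((s - d) `^ (- b))%:E).
Proof.
move=> a0 xyd.
rewrite -ge0_integral_itvoy_shift; last 2 first.
- by apply: measurable_shifted_density; exact: measurable_itv.
- by move=> t; rewrite mule_ge0 ?poweR_ge0// lee_fin powR_ge0.
apply: ge0_le_integral => //.
- by move=> r _; exact: density_ge0.
- exact: measurable_density.
- apply: measurable_funTS.
  apply: (@measurableT_comp _ _ _ _ _ _
    (fun s => mu (eball y s) `^ q * ((s - d) `^ (- b))%:E)).
    by apply: measurable_shifted_density; exact: measurableT.
  exact: measurable_funD.
move=> r _; rewrite /density addrK lee_wpmul2r ?lee_fin ?powR_ge0//.
apply: le_poweR => //; first exact: ltW.
by apply: le_mu_eball; rewrite addrC lerD2l.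
Qed.

(** Turns the bound on the maximal function into a growth bound for balls centered at [x], the only
    form in which it is used later. *)
Lemma M_frac_le (mu : {measure set E -> \bar R}) x (K : R) :
  (0 <= K)%R -> M_frac alpha mu x `^ q <= (K `^ q)%:E ->
  forall r, (0 < r)%R -> mu (eball x r) <= (K * r `^ gam)%:E.
Proof.
move=> K0 MK r r0.
have M_ub : mu (eball x r) * (r `^ (alpha - n%:R))%:E <= M_frac alpha mu x.
  by apply: ereal_sup_ubound; exists r => //=; rewrite in_itv/= r0.
have M0 : 0 <= M_frac alpha mu x.
  by apply: le_trans M_ub; rewrite mule_ge0// lee_fin powR_ge0.
have {MK} : M_frac alpha mu x <= K%:E.
  rewrite -[leLHS]poweRe1// -(@mulfV _ q) ?gt_eqF// poweRrM.
  rewrite (@le_trans _ _ ((K `^ q)%:E `^ q^-1))//.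
    by apply: le_poweR => //; [rewrite invr_ge0 ltW|exact: poweR_ge0].
  by rewrite poweR_EFin -powRrM mulfV ?gt_eqF// powRr1.
move=> /(le_trans M_ub) H.
rewrite (_ : mu (eball x r) =
  mu (eball x r) * (r `^ (alpha - n%:R))%:E * (r `^ gam)%:E); last first.
  rewrite -muleA -EFinM -powRD; last by rewrite (gt_eqF r0) implybT.
  by rewrite [X in powR _ X](_ : _ = 0%R) ?powRr0 ?mule1//; ring.
by rewrite EFinM; apply: lee_wpmul2r => //; rewrite lee_fin powR_ge0.
Qed.

(* Cutting the integral at a small [a > 0] loses little, and moving the center by [d]
   then costs a factor [(1 + d/a)^b]. *)
Lemma T_pot_gt_open (mu : {measure set E -> \bar R}) x (lambda : R) :
  (0 < lambda)%R -> lambda%:E < T_pot alpha q mu x `^ q ->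
  exists2 d : R, (0 < d)%R & forall y, (eucl_dist x y <= d)%R ->
    lambda%:E < T_pot alpha q mu y `^ q.
Proof.
move=> l0 lx.
(* The integrals over []1/(i+1), +oo[] increase to the full one, so some of them already exceeds
   [lambda]. *)
have [a a0 la] : exists2 a : R, (0 < a)%R &
    lambda%:E < \int[leb]_(r in `]a, +oo[) density mu x r.
  apply: contrapT => H.
  have H' i : \int[leb]_(r in `]i.+1%:R^-1%R, +oo[) density mu x r <= lambda%:E.
    by rewrite leNgt; apply/negP => Hi; apply: H; exists (i.+1%:R^-1)%R.
  move: lx; rewrite T_potE ltNge => /negP; apply.
  have -> : `]0%R, +oo[%classic = \bigcup_i `](i.+1%:R^-1)%R, +oo[%classic :> set R.
    apply/seteqP; split => [t|t [i _]]; rewrite /= !in_itv/= !andbT => t0; last first.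
      by rewrite (lt_trans _ t0).
    exists (Num.truncn t^-1); rewrite //= in_itv/= andbT.
    rewrite invf_plt ?posrE//; exact: Num.Theory.truncnS_gt.
  pose F i : set (measurableTypeR R) := `](i.+1%:R^-1)%R, +oo[%classic.
  have cv : \int[leb]_(r in F i) density mu x r @[i --> \oo] -->
      \int[leb]_(r in \bigcup_i F i) density mu x r.
    apply: ge0_nondecreasing_set_cvg_integral.
    - move=> i j ij; apply/subsetPset => t; rewrite /F /= !in_itv/= !andbT.
      by apply: le_lt_trans; rewrite lef_pV2 ?posrE// ler_nat.
    - by move=> i; exact: measurable_itv.
    - by move=> i; apply: measurable_density; exact: measurable_itv.
    - by move=> i t _; exact: density_ge0.
  rewrite -(cvg_lim _ cv)//; apply: lime_le; last by near=> i; exact: H'.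
  by apply/cvg_ex; eexists; exact: cv.
(* A finite intermediate level is chosen because the integral may be infinite. *)
have [l' ll' l'a] : exists2 l' : R, (lambda < l')%R &
    l'%:E <= \int[leb]_(r in `]a, +oo[) density mu x r.
  case: (\int[leb]_(r in `]a, +oo[) density mu x r) la => [j|_|//].
    by rewrite lte_fin => lj; exists j.
  by exists (lambda + 1)%R; [rewrite ltrDl|rewrite leey].
have [N HN] := powR1D_le b.
(* The minimum with 1 admits the linear bound [HN]; the factor 2 in the denominator makes
   [(1 + 2^N v) lambda < l'] strict. The displacement will be [d = a v]. *)
pose v := Num.min 1%R ((l' - lambda) / (2 * 2 ^+ N * lambda))%R.
have v_gt0 : (0 < v)%R.
  by rewrite lt_min ltr01/= divr_gt0 ?subr_gt0// !mulr_gt0.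
have v_le1 : (v <= 1)%R by rewrite ge_min lexx.
have vl : ((1 + 2 ^+ N * v) * lambda < l')%R.
  have : (v <= (l' - lambda) / (2 * 2 ^+ N * lambda))%R by rewrite ge_min lexx orbT.
  rewrite ler_pdivlMr ?mulr_gt0//; lra.
exists (a * v)%R; first exact: mulr_gt0.
move=> y xy; rewrite ltNge; apply/negP => Ty.
have av0 : (0 < a * v)%R by rewrite mulr_gt0.
suff : \int[leb]_(r in `]a, +oo[) density mu x r <= ((1 + 2 ^+ N * v) * lambda)%:E.
  by move=> /(le_trans l'a); rewrite lee_fin leNgt vl.
apply: (le_trans (T_pot_le_shift mu a0 xy)).
have c0 : (0 <= 1 + 2 ^+ N * v)%R by rewrite addr_ge0// mulr_ge0// ltW.
rewrite EFinM; apply: le_trans (lee_wpmul2l _ Ty); last by rewrite lee_fin.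
rewrite T_potE -ge0_integralZl_EFin//; last 2 first.
- by move=> r _; exact: density_ge0.
- by apply: measurable_density; exact: measurable_itv.
apply: (@le_trans _ _ (\int[leb]_(s in `](a + a * v)%R, +oo[)
    ((1 + 2 ^+ N * v)%:E * density mu y s))).
  apply: ge0_le_integral => //.
  - by move=> s _; rewrite mule_ge0 ?poweR_ge0// lee_fin powR_ge0.
  - by apply: measurable_shifted_density; exact: measurable_itv.
  - by apply: measurable_funeM; exact: measurable_density.
  move=> s; rewrite /= in_itv/= andbT => s0.
  rewrite /density muleCA lee_wpmul2l ?poweR_ge0// -EFinM lee_fin.
  have sav : (0 < s - a * v)%R by rewrite subr_gt0 (lt_trans _ s0)// ltrDr.
  rewrite -!powR_invl ?(ltW sav)//; last by rewrite ltW// (lt_trans _ s0)// addr_gt0.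
  (* For [s > a + a v] one has [s <= (1 + v) (s - a v)]. *)
  apply: (@le_trans _ _ (((1 + v) * s^-1) `^ b)%R).
    apply: ge0_ler_powR; rewrite ?nnegrE ?(ltW b_gt0)//.
    - by rewrite invr_ge0 ltW.
    - by rewrite mulr_ge0 ?addr_ge0 ?invr_ge0 ?(ltW v_gt0)// (le_trans (ltW sav))// gerBl ltW.
    have s1 : (0 < s)%R by rewrite (lt_trans _ s0)// addr_gt0.
    rewrite ler_pdivlMr// mulrC ler_pdivrMr// -subr_ge0.
    have -> : ((1 + v) * (s - a * v) - s = v * (s - (a + a * v)))%R by ring.
    by rewrite mulr_ge0 ?(ltW v_gt0)// subr_ge0 ltW.
  rewrite powRM ?addr_ge0 ?invr_ge0 ?(ltW v_gt0)//; last first.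
    by rewrite ltW// (lt_trans _ s0)// addr_gt0.
  apply: ler_wpM2r; first exact: powR_ge0.
  by apply: HN; rewrite ltW.
apply: le_integral_set => [s|s].
  by rewrite mule_ge0 ?density_ge0// lee_fin.
by rewrite /= !in_itv/= !andbT; apply: lt_trans; rewrite addr_gt0.
Unshelve. all: by end_near. Qed.

(** After the shift [s = r + rho > 2 rho], the weight [(s - rho)^-b] is at most [s^-b] times
    [1 + 2^N (2 rho / s)]. The term 1 gives a part of the potential at [y]. In the other term the
    growth bound at [x] leaves a multiple of [K^q rho s^-2], whose integral over [s > 2 rho] does
    not depend on [rho]. *)
Lemma T_pot_tail_le : exists2 C1 : R, (0 <= C1)%R &
  forall (mu : {measure set E -> \bar R}) x y (rho K : R),
    (0 < rho)%R -> (0 <= K)%R -> (eucl_dist x y <= rho)%R ->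
    (forall r, (0 < r)%R -> mu (eball x r) <= (K * r `^ gam)%:E) ->
    \int[leb]_(r in `]rho, +oo[) density mu x r <=
      T_pot alpha q mu y `^ q + (C1 * K `^ q)%:E.
Proof.
have [N HN] := powR1D_le b.
(* The first factor comes from doubling a radius in the growth bound, the second from the linear
   bound on [(1 + v)^b]. *)
pose C1 := ((2 `^ gam) `^ q * 2 ^+ N)%R.
have C1_ge0 : (0 <= C1)%R by rewrite mulr_ge0 ?powR_ge0.
exists C1 => // mu x y rho K rho0 K0 xy Kmu.
apply: (le_trans (T_pot_le_shift mu rho0 xy)).
have rr0 : (0 < rho + rho)%R by rewrite addr_gt0.
apply: (@le_trans _ _ (\int[leb]_(s in `](rho + rho)%R, +oo[)
    (density mu y s + (2 * C1 * K `^ q * rho)%:E * (s ^- 2)%:E))).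
  apply: ge0_le_integral => //.
  - by move=> s _; rewrite mule_ge0 ?poweR_ge0// lee_fin powR_ge0.
  - by apply: measurable_shifted_density; exact: measurable_itv.
  - apply: emeasurable_funD.
      by apply: measurable_density; exact: measurable_itv.
    by apply: measurable_funeM; exact: measurable_inv_sqr.
  move=> s; rewrite /= in_itv/= andbT => rrs.
  have s0 : (0 < s)%R := lt_trans rr0 rrs.
  have sr0 : (0 < s - rho)%R by lra.
  (* Growth is known only at [x]: since [rho < s], the ball [B(y, s)] lies in [B(x, 2 s)]. *)
  have Gs : mu (eball y s) `^ q <= (K `^ q * (2 `^ gam) `^ q * (s `^ gam) `^ q)%:E.
    rewrite -!powRM ?powR_ge0// ?mulr_ge0 ?powR_ge0 ?ler0n// -poweR_EFin.
    apply: le_poweR => //; first exact: ltW.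
    rewrite -mulrA -powRM// ?(ltW s0)//.
    apply: le_trans (Kmu _ _); last by rewrite mulr_gt0.
    by apply: le_mu_eball; rewrite eucl_distC; lra.
  have sb : ((s - rho) `^ (- b) <= s `^ (- b) * (1 + 2 ^+ N * (2 * rho / s)))%R.
    rewrite -!powR_invl ?(ltW s0) ?(ltW sr0)//.
    apply: (@le_trans _ _ ((s^-1 * (1 + 2 * rho / s)) `^ b)%R).
      apply: ge0_ler_powR; rewrite ?nnegrE ?(ltW b_gt0)//.
      - by rewrite invr_ge0 ltW.
      - by rewrite mulr_ge0 ?addr_ge0 ?divr_ge0 ?invr_ge0 ?mulr_ge0 ?(ltW s0) ?(ltW rho0).
      rewrite -subr_ge0.
      have -> : (s^-1 * (1 + 2 * rho / s) - (s - rho)^-1 =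
          rho * (s - (rho + rho)) / (s ^+ 2 * (s - rho)))%R.
        by field; rewrite !gt_eqF.
      apply: divr_ge0; first by rewrite mulr_ge0 ?(ltW rho0)// subr_ge0 ltW.
      by rewrite mulr_ge0 ?sqr_ge0 ?(ltW sr0).
    rewrite powRM ?addr_ge0 ?invr_ge0 ?divr_ge0 ?mulr_ge0 ?(ltW s0) ?(ltW rho0)//.
    apply: ler_wpM2l; first exact: powR_ge0.
    apply: HN; rewrite divr_ge0 ?mulr_ge0 ?(ltW s0) ?(ltW rho0)//=.
    by rewrite ler_pdivrMr//; lra.
  apply: (@le_trans _ _ (mu (eball y s) `^ q *
      (s `^ (- b) * (1 + 2 ^+ N * (2 * rho / s)))%:E)).
    by rewrite lee_wpmul2l ?poweR_ge0 ?lee_fin.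
  have X0 : (0 <= s `^ (- b) * (2 ^+ N * (2 * rho / s)))%R.
    by rewrite !mulr_ge0 ?powR_ge0 ?invr_ge0 ?exprn_ge0 ?(ltW s0) ?(ltW rho0).
  rewrite mulrDr mulr1 EFinD ge0_muleDr ?lee_fin ?powR_ge0//.
  apply: leeD => //.
  apply: (le_trans (lee_wpmul2r _ Gs)); first by rewrite lee_fin.
  rewrite -!EFinM lee_fin le_eqVlt; apply/orP; left; apply/eqP.
  have ST : ((s `^ gam) `^ q * s `^ (- b) = s^-1)%R.
    rewrite -powRrM -powRD; last by rewrite (gt_eqF s0) implybT.
    by rewrite -powR_inv1 ?(ltW s0)//; congr (powR _ _); ring.
  rewrite /C1; set A := ((2 `^ gam) `^ q)%R; set kq := (K `^ q)%R.
  clearbody A kq.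
  transitivity (kq * A * ((s `^ gam) `^ q * s `^ (- b)) * (2 ^+ N * (2 * rho / s)))%R.
    by move: ((s `^ gam) `^ q)%R (s `^ (- b))%R => S T; ring.
  by rewrite ST; field; rewrite gt_eqF.
have D0 : (0 <= 2 * C1 * K `^ q * rho)%R.
  by rewrite !mulr_ge0 ?powR_ge0 ?(ltW rho0).
have i20 s : 0 <= (s ^- 2)%:E :> \bar R by rewrite lee_fin invr_ge0 sqr_ge0.
rewrite ge0_integralD//; last 4 first.
- by move=> s _; exact: density_ge0.
- by apply: measurable_density; exact: measurable_itv.
- by move=> s _; rewrite mule_ge0// lee_fin.
- by apply: measurable_funeM; exact: measurable_inv_sqr.
apply: leeD.
  rewrite T_potE; apply: le_integral_set => [s|s]; first exact: density_ge0.
  by rewrite /= !in_itv/= !andbT; exact: lt_trans.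
rewrite ge0_integralZl_EFin//; last exact: measurable_inv_sqr.
rewrite integral_inv_sqr// -EFinM lee_fin le_eqVlt; apply/orP; left; apply/eqP.
by field; rewrite gt_eqF.
Qed.

(** On each dyadic shell the mass is estimated at the outer radius and the weight [r^-b] at the
    inner one. The powers of the radius cancel against the length of the shell, and a geometric
    series of ratio [w^q] remains. *)
Lemma T_pot_local_le (mu : {measure set E -> \bar R}) x (rho H K : R) :
  (0 < rho)%R -> (0 <= H)%R -> (0 <= K)%R ->
  (forall j, mu (eball x (rho * 2^-1 ^+ j)%R) <=
    (H * K * (rho * 2^-1 ^+ j) `^ gam * (2^-1 `^ (alpha / 2)) ^+ j)%:E) ->
  \int[leb]_(r in `]0%R, rho]) density mu x r <=
    (((2 `^ gam) `^ q / (1 - (2^-1 `^ (alpha / 2)) `^ q)) * H `^ q * K `^ q)%:E.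
Proof.
move=> rho0 H0 K0 muj.
set w := (2^-1 `^ (alpha / 2))%R in muj *.
have /andP[w_gt0 w_lt1] : (0 < w < 1)%R := half_powR_itv alpha_gt0.
clearbody w.
have s_gt0 j : (0 < rho * 2^-1 ^+ j)%R by rewrite mulr_gt0// exprn_gt0// invr_gt0.
pose c j := ((H * K * (rho * 2^-1 ^+ j) `^ gam * w ^+ j) `^ q
             * (rho * 2^-1 ^+ j.+1) `^ (- b))%R.
apply: (le_trans (@dyadic_integral_le _ _ _ c _ _ _ _)) => //.
- by apply: measurable_density; exact: measurable_itv.
- by move=> t; exact: density_ge0.
- move=> j t /andP[t1 t2]; rewrite /density /c EFinM.
  have t0 : (0 < t)%R := lt_trans (s_gt0 _) t1.
  apply: lee_pmul; rewrite ?poweR_ge0 ?lee_fin ?powR_ge0//.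
    rewrite -poweR_EFin; apply: le_poweR => //; first exact: ltW.
    by apply: le_trans (muj j); apply: le_mu_eball; rewrite eucl_distxx add0r.
  rewrite !powRN lef_pV2 ?posrE ?powR_gt0// ge0_ler_powR ?nnegrE ?(ltW b_gt0) ?ltW//.
apply: (@le_trans _ _ (\sum_(0 <= j <oo)
    ((2 `^ gam) `^ q * H `^ q * K `^ q * (w `^ q) ^+ j)%:E)).
  apply: lee_nneseries => j _.
    by rewrite lee_fin mulr_ge0 ?mulr_ge0 ?powR_ge0// ltW.
  rewrite lee_fin le_eqVlt; apply/orP; left; apply/eqP.
  have -> : ((w `^ q) ^+ j = (w ^+ j) `^ q)%R.
    by rewrite -(powR_mulrn j (ltW w_gt0)) powRAC powR_mulrn ?powR_ge0.
  have u_gt0 := s_gt0 j.+1; set u := (rho * 2^-1 ^+ j.+1)%R in u_gt0.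
  have su : (rho * 2^-1 ^+ j = 2 * u)%R by rewrite /u exprS; field.
  rewrite /c -/u su; clearbody u.
  rewrite !powRM ?mulr_ge0 ?powR_ge0 ?exprn_ge0 ?(ltW w_gt0) ?(ltW u_gt0)//.
  (* The exponents [q gam], [- b] and 1 add up to 0. *)
  have U : ((u `^ gam) `^ q * u `^ (- b) * u = 1)%R.
    rewrite -powRrM -[X in (_ * X)%R](@powRr1 _ u) ?(ltW u_gt0)//.
    rewrite -!powRD ?(gt_eqF u_gt0) ?implybT//.
    by rewrite [X in powR _ X](_ : _ = 0%R) ?powRr0//; ring.
  set A := ((2 `^ gam) `^ q)%R; set W := ((w ^+ j) `^ q)%R.
  set hq := (H `^ q)%R; set kq := (K `^ q)%R.
  clearbody A W hq kq.
  transitivity (A * hq * kq * W * ((u `^ gam) `^ q * u `^ (- b) * u))%R.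
    by move: ((u `^ gam) `^ q)%R (u `^ (- b))%R => S T; ring.
  by rewrite U mulr1.
apply: (le_trans (geometric_eseries_le _ _)).
- by rewrite !mulr_ge0 ?powR_ge0.
- by rewrite powR_ge0/=; have /andP[] := powR_itv01 (introT andP (conj w_gt0 w_lt1)) q_gt0.
rewrite lee_fin le_eqVlt; apply/orP; left; apply/eqP.
by rewrite -!mulrA; congr (_ * _)%R; rewrite [RHS]mulrC -mulrA.
Qed.

End potential.

(** * Grids and the exceptional set in a cube *)

Section grid.
Context (R : realType) (n : nat).
Local Notation E := (euclid R n).

Definition grid_point (s : R) (m : n.-tuple int) : E :=
  [tuple (s * (tnth m i)%:~R)%R | i < n].

Lemma coord_grid_point s m i : tcoord (grid_point s m) i = (s * (tnth m i)%:~R)%R.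
Proof. by rewrite /tcoord tnth_mktuple. Qed.

(** Each coordinate of [x / s] is rounded to a nearest integer. *)
Lemma grid_cover (s : R) (x : E) : (0 < s)%R ->
  exists m, box (grid_point s m) (s / 2) x.
Proof.
move=> s0; exists [tuple Num.floor (tcoord x i / s + 2^-1)%R | i < n] => i.
rewrite coord_grid_point tnth_mktuple.
set f := Num.floor _.
have f1 : (f%:~R <= tcoord x i / s + 2^-1)%R by exact: Num.Theory.floor_le_tmp.
have f2 : (tcoord x i / s + 2^-1 < f%:~R + 1)%R.
  by have := floorD1_gt (tcoord x i / s + 2^-1)%R; rewrite intrD.
have xs : (tcoord x i = s * (tcoord x i / s))%R by field; rewrite gt_eqF.
rewrite {}xs ler_norml; set t := (tcoord x i / s)%R in f1 f2 *.
by apply/andP; split; nra.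
Qed.

(* Colors of the grid: distinct points of equal residues are at least [N.+1] steps apart. *)
Definition residue N (m : n.-tuple int) : n.-tuple 'I_N.+1 :=
  [tuple inord `|(tnth m i %% N.+1%:Z)%Z|%N | i < n].

Lemma residue_inj N (m p : n.-tuple int) : residue N m = residue N p ->
  (forall i, (`|tnth m i - tnth p i| < N.+1%:Z)%R) -> m = p.
Proof.
move=> mp H; apply: eq_from_tnth => i; have := H i.
have : (tnth m i %% N.+1%:Z = tnth p i %% N.+1%:Z)%Z.
  move: (congr1 (fun t => nat_of_ord (tnth t i)) mp); rewrite !tnth_mktuple.
  have N0 : (N.+1%:Z != 0)%R by [].
  have lt_mod z : (`|(z %% N.+1%:Z)%Z| < N.+1)%N.
    by rewrite -ltz_nat gez0_abs ?modz_ge0// ltz_pmod.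
  rewrite !inordK// => h.
  by rewrite -[LHS]gez0_abs ?modz_ge0// -[RHS]gez0_abs ?modz_ge0// h.
move=> /eqP; rewrite eqz_mod_dvd => /dvdzP[k mpk]; rewrite mpk.
rewrite normrM => hk; have k0 : k = 0%R by nia.
by apply/eqP; rewrite -subr_eq0 mpk k0 mul0r.
Qed.

(** Centers of two boxes through [z] differ by at most [2 r] in each coordinate, hence by fewer than
    [N.+1] grid steps. *)
Lemma grid_box_inj N (s r : R) (m p : n.-tuple int) (z : E) : (0 < s)%R ->
  (2 * r < N.+1%:R * s)%R -> residue N m = residue N p ->
  box (grid_point s m) r z -> box (grid_point s p) r z -> m = p.
Proof.
move=> s0 rs mp zm zp; apply: residue_inj mp _ => i.
have := zm i; have := zp i; rewrite !coord_grid_point => h1 h2.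
rewrite -(ltr_int R) intr_norm intrB -(ltr_pM2l s0).
rewrite -[X in (X * `|_|)%R](ger0_norm (ltW s0)) -normrM mulrBr.
apply: le_lt_trans (_ : 2 * r < _)%R; last by rewrite [ltRHS]mulrC.
move: h1 h2; rewrite !ler_norml => /andP[h1 h2] /andP[h3 h4].
by apply/andP; split; lra.
Qed.

End grid.

(** * The exceptional set where small balls carry too much mass *)

Section bad_set.
Context (R : realType) (n : nat) (alpha : R).
Hypotheses (n_gt0 : (0 < n)%N) (alpha_gt0 : (0 < alpha)%R) (alpha_ltn : (alpha < n%:R)%R).
Local Notation E := (euclid R n).
Local Notation gam := (n%:R - alpha)%R.
Local Notation w := (2^-1 `^ (alpha / 2))%R.

(** At scale [s j = rho / 2^j], discard the grid cells [P j m] meeting the cube whose triple [B j m]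
    has mass above [tau j]. The triples overlap boundedly inside one ball [U] around [x1], so at
    most [4^n mu(U) / tau j] cells go, and the measures lost are summable in [j]. For a point of a
    kept cell, the ball of radius [s j] lies in the triple. *)
Lemma small_balls_off_bad_set (mu : {measure set E -> \bar R}) (a x1 : E) (l rho H K : R) :
  (0 < l <= rho)%R -> (0 < H)%R -> (0 < K)%R -> box a (l / 2) x1 ->
  (forall r, (0 < r)%R -> mu (eball x1 r) <= (K * r `^ gam)%:E) ->
  exists Bad : set E, [/\ measurable Bad,
    borel_lebesgue R n Bad <=
      (4 ^+ n * (4 * n%:R) `^ gam / (1 - w) / H * rho ^+ n)%:E &
    forall x j, box a (l / 2) x -> ~ Bad x ->
      mu (eball x (rho * 2^-1 ^+ j)%R) <=
      (H * K * (rho * 2^-1 ^+ j) `^ gam * w ^+ j)%:E].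
Proof.
move=> /andP[l0 lr] H0 K0 x1a Kmu.
have rho0 : (0 < rho)%R := lt_le_trans l0 lr.
have /andP[w0 w1] := half_powR_itv alpha_gt0.
pose s j := (rho * 2^-1 ^+ j)%R.
have s0 j : (0 < s j)%R by rewrite mulr_gt0// exprn_gt0// invr_gt0.
have sr j : (s j <= rho)%R.
  by rewrite /s ler_piMr ?(ltW rho0)// exprn_ile1// invf_le1// ler1n.
pose tau j := (H * K * s j `^ gam * w ^+ j)%R.
have tau0 j : (0 < tau j)%R by rewrite !mulr_gt0 ?powR_gt0 ?exprn_gt0.
pose P j (m : n.-tuple int) := box (grid_point (s j) m) (s j / 2).
pose B j (m : n.-tuple int) := box (grid_point (s j) m) (s j * (3 / 2)).
pose D j : set (n.-tuple int) :=
  [set m | P j m `&` box a (l / 2) !=set0 /\ (tau j)%:E < mu (B j m)].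
pose Bad := \bigcup_j \bigcup_(m in D j) P j m.
(* A point of a triple is within [2 s j + l <= 3 rho] of [x1] in each coordinate, hence at Euclidean
   distance less than [4 n rho]. *)
pose U := eball x1 (4 * n%:R * rho)%R.
have n0 : (0 < n%:R :> R)%R by rewrite ltr0n.
have BU j m : D j m -> B j m `<=` U.
  move=> [[p [pP pa]] _] z zB.
  apply: (@le_lt_trans _ _ (n%:R * (3 * rho))%R); last first.
    by rewrite mulrCA mulrA ltr_pM2r// ltr_pM2r// ltr_nat.
  apply: eucl_dist_le_sup => // i.
  move: (pP i) (pa i) (zB i) (x1a i) (sr j) (lr).
  set g := tcoord (grid_point _ _) i; rewrite !ler_norml.
  move=> /andP[? ?] /andP[? ?] /andP[? ?] /andP[? ?] ? ?.
  by apply/andP; split; lra.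
have mP j m : measurable (P j m) by exact: measurable_box.
have mB j m : measurable (B j m) by exact: measurable_box.
have Uj j : borel_lebesgue R n (\bigcup_(m in D j) P j m) <=
    (4 ^+ n * (4 * n%:R) `^ gam / H * rho ^+ n * w ^+ j)%:E.
  apply: (@le_trans _ _ ((#|{: n.-tuple 'I_4}|%:R * (s j ^+ n / tau j))%:E * mu U)).
    (* Residues modulo 4: closed triples of cells three steps apart may still touch. *)
    apply: (@colored_family_le R _ _ _ _ _ _ mu _ (@residue n 3) (D j) _ (B j)) => //.
    - by rewrite divr_ge0 ?exprn_ge0 ?(ltW (s0 j)) ?(ltW (tau0 j)).
    - move=> m p _ _ mp [z [zm zp]].
      by apply: (grid_box_inj (s0 j) _ mp zm zp); have := s0 j; lra.
    - move=> m [_ tm].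
      have Pm : borel_lebesgue R n (P j m) = (s j ^+ n)%:E.
        rewrite borel_lebesgue_box ?divr_ge0 ?(ltW (s0 j))//.
        by congr (_ ^+ _)%:E; field.
      apply: (@le_trans _ _ (s j ^+ n)%:E); first by rewrite -Pm.
      have -> : (s j ^+ n)%:E = (s j ^+ n / tau j)%:E * (tau j)%:E.
        by rewrite -EFinM divfK// gt_eqF.
      apply: lee_wpmul2l; last exact: ltW.
      by rewrite lee_fin divr_ge0 ?exprn_ge0 ?(ltW (s0 j)) ?(ltW (tau0 j)).
    - exact: measurable_eball.
    - exact: BU.
  have X0 : (0 <= #|{: n.-tuple 'I_4}|%:R * (s j ^+ n / tau j))%R.
    by rewrite mulr_ge0// divr_ge0 ?exprn_ge0 ?(ltW (s0 j)) ?(ltW (tau0 j)).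
  apply: (le_trans (lee_wpmul2l _ (Kmu (4 * n%:R * rho)%R _))).
  - by rewrite lee_fin.
  - by rewrite !mulr_gt0.
  rewrite -EFinM lee_fin card_tuple card_ord natrX le_eqVlt; apply/orP; left; apply/eqP.
  rewrite (@powRM _ (4 * n%:R)%R) ?mulr_ge0 ?(ltW rho0) ?(ltW n0)//.
  (* With [s = s j], [s^n = s^gam rho^alpha w^(2j)]. Division by [tau j] cancels [s^gam] and one
     factor [w^j]; the remaining [w^j] gives summability. *)
  have rhon : (rho ^+ n = rho `^ gam * rho `^ alpha)%R.
    rewrite -powRD; last by rewrite (gt_eqF rho0) implybT.
    by rewrite subrK powR_mulrn// ltW.
  have wj : (s j `^ alpha = rho `^ alpha * (w ^+ j) ^+ 2)%R.
    rewrite /s powRM ?(ltW rho0)//; congr (_ * _)%R.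
    have w2 : (w ^+ 2 = 2^-1 `^ alpha)%R.
      rewrite -(powR_mulrn 2 (ltW w0)) -powRrM; congr (powR _ _).
      by rewrite divfK.
    rewrite exprAC w2 -(@powR_mulrn _ (2^-1 `^ alpha)%R) ?powR_ge0//.
    by rewrite powRAC powR_mulrn ?invr_ge0.
  have sn : (s j ^+ n = s j `^ gam * (rho `^ alpha * (w ^+ j) ^+ 2))%R.
    rewrite -wj -powRD; last by rewrite (gt_eqF (s0 j)) implybT.
    by rewrite subrK powR_mulrn// ltW.
  rewrite sn rhon /tau.
  have : (s j `^ gam != 0)%R by rewrite gt_eqF// powR_gt0.
  have : (w ^+ j != 0)%R by rewrite gt_eqF// exprn_gt0.
  have : (H != 0)%R by rewrite gt_eqF.
  have : (K != 0)%R by rewrite gt_eqF.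
  clear.
  move: (w ^+ j)%R (s j `^ gam)%R (rho `^ alpha)%R (rho `^ gam)%R => W S r1 r2.
  move: ((4 * n%:R) `^ gam)%R (4 ^+ n)%R => A4 F K0 H0 W0 S0.
  by field; rewrite K0 H0 W0 S0.
exists Bad; split.
- apply: bigcupT_measurable => j; exact: countable_bigcup_measurable.
- apply: (@le_trans _ _ (\sum_(0 <= j <oo)
    (4 ^+ n * (4 * n%:R) `^ gam / H * rho ^+ n * w ^+ j)%:E)).
    apply: (@le_trans _ _ (\sum_(0 <= j <oo)
        borel_lebesgue R n (\bigcup_(m in D j) P j m))).
      apply: measure_sigma_subadditive => //.
      - by move=> j; exact: countable_bigcup_measurable.
      - by apply: bigcupT_measurable => j; exact: countable_bigcup_measurable.
    exact: lee_nneseries.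
  apply: (le_trans (geometric_eseries_le _ _)).
  + by rewrite !mulr_ge0 ?powR_ge0 ?invr_ge0 ?exprn_ge0 ?(ltW H0) ?(ltW rho0).
  + by rewrite (ltW w0).
  rewrite lee_fin le_eqVlt; apply/orP; left; apply/eqP.
  move: ((4 * n%:R) `^ gam)%R w w0 w1 => A W W0 W1.
  by field; rewrite gt_eqF//= subr_eq0 gt_eqF.
move=> x j xa xBad.
have [m xm] := grid_cover x (s0 j).
have nD : ~ D j m by move=> Dm; apply: xBad; exists j => //; exists m.
have Bm : mu (B j m) <= (tau j)%:E.
  by rewrite leNgt; apply/negP => h; apply: nD; split => //; exists x.
apply: le_trans Bm; apply: le_measure; rewrite ?inE//; first exact: measurable_eball.
move=> z xz i; have := le_lt_trans (ler_coord_eucl_dist x z i) xz.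
have := xm i; rewrite -/(s j).
set g := tcoord (grid_point _ _) i; rewrite !ltr_norml !ler_norml.
by move=> /andP[? ?] /andP[? ?]; apply/andP; split; lra.
Qed.

End bad_set.

(** * The weight as a measure, and Lebesgue measure on Borel sets *)

Section weighted_measure.
Context (R : realType) (n : nat) (sigma : leb_euclid R n -> R).
Hypotheses (msigma : measurable_fun setT sigma) (sigma0 : forall x, (0 <= sigma x)%R).

Let weighted0 : weighted sigma set0 = 0.
Proof. by rewrite /weighted integral_set0. Qed.

Let weighted_ge0 A : 0 <= weighted sigma A.
Proof. by apply: integral_ge0 => x _; rewrite lee_fin. Qed.

Let weighted_sigma_additive : semi_sigma_additive (weighted sigma).
Proof.
apply: semi_sigma_additive_nng_induced => [|x]; last by rewrite lee_fin.
exact/measurable_EFinP.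
Qed.

Definition weighted_measure : {measure set (leb_euclid R n) -> \bar R} :=
  HB.pack (weighted sigma)
    (isMeasure.Build _ _ _ (weighted sigma) weighted0 weighted_ge0 weighted_sigma_additive).

(** Stated for arbitrary sets, so that it applies to the good-lambda set, whose measurability is not
    established. *)
Lemma le_weighted (A B : set (leb_euclid R n)) :
  A `<=` B -> weighted sigma A <= weighted sigma B.
Proof. by move=> AB; apply: le_integral_set => // x; rewrite lee_fin. Qed.

End weighted_measure.

Section lebesgue_borel.
Context (R : realType) (n : nat).
Local Notation E := (euclid R n).

Lemma measurable_leb (A : set E) : measurable A ->
  measurable (A : set (leb_euclid R n)).
Proof. move=> mA; apply: sub_caratheodory. exact: sub_sigma_algebra. Qed.

(** Bridge from the completed measure in the weight condition to the product measure used for boxes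
    and exceptional sets. *)
Lemma lebesgueE (A : set E) : measurable A ->
  lebesgue (A : set (leb_euclid R n)) = borel_lebesgue R n A.
Proof. by move=> mA; rewrite /lebesgue /completed_measure_extension measurable_mu_extE. Qed.

Lemma lebesgue_cube (a : leb_euclid R n) (l : R) : (0 <= l)%R ->
  lebesgue (cube a l) = (l ^+ n)%:E.
Proof.
move=> l0; rewrite (lebesgueE (measurable_box a (l / 2)%R)).
by rewrite borel_lebesgue_box ?divr_ge0// mulrC divfK.
Qed.

End lebesgue_borel.

(** * The good-lambda estimate in a single cube *)

Section good_lambda_cube.
Context (R : realType) (n : nat) (alpha q : R).
Hypotheses (n_gt0 : (0 < n)%N) (alpha_gt0 : (0 < alpha)%R)
  (alpha_ltn : (alpha < n%:R)%R) (q_gt0 : (0 < q)%R).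
Local Notation E := (euclid R n).

Definition good_lambda_set (mu : {measure set E -> \bar R}) (c eps lambda : R) : set E :=
  [set x | ((1 + c * eps) * lambda)%:E < T_pot alpha q mu x `^ q
           /\ M_frac alpha mu x `^ q <= (eps * lambda)%:E].

(** The order of choice matters: [delta] fixes [H], and [H] fixes [c]. Off the exceptional set the
    local part of [T^q] is at most [C2 eps lambda] and the tail at most [lambda + C1 eps lambda],
    which contradicts the lower bound on [T^q]. *)
Lemma good_lambda_in_cube (delta : R) : (0 < delta)%R -> exists2 c : R, (1 < c)%R &
  forall (mu : {measure set E -> \bar R}) (lambda eps : R) (a x0 : E) (l : R),
    (0 < lambda)%R -> (0 < eps)%R -> (0 < l)%R ->
    (forall x, box a (l / 2) x -> (eucl_dist x x0 <= 9 * n%:R * l)%R) ->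
    T_pot alpha q mu x0 `^ q <= lambda%:E ->
    exists Bad : set E, [/\ measurable Bad, Bad `<=` box a (l / 2),
      borel_lebesgue R n Bad <= (delta * l ^+ n)%:E &
      good_lambda_set mu c eps lambda `&` box a (l / 2) `<=` Bad].
Proof.
move=> delta0.
have [C1 C1_ge0 HC1] := T_pot_tail_le alpha_ltn q_gt0.
have /andP[w0 w1] := half_powR_itv alpha_gt0.
set w := (2^-1 `^ (alpha / 2))%R in w0 w1.
pose C3 := (4 ^+ n * (4 * n%:R) `^ (n%:R - alpha) / (1 - w) * (9 * n%:R) ^+ n)%R.
have n0 : (0 < n%:R :> R)%R by rewrite ltr0n.
have C3_gt0 : (0 < C3)%R.
  by rewrite !mulr_gt0 ?powR_gt0 ?exprn_gt0 ?mulr_gt0 ?invr_gt0 ?subr_gt0.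
(* With [rho = 9 n l], the measure bound for the exceptional set becomes exactly [delta l^n]. *)
pose H := (C3 / delta)%R.
have H0 : (0 < H)%R by rewrite divr_gt0.
pose C2 := ((2 `^ (n%:R - alpha)) `^ q / (1 - w `^ q) * H `^ q)%R.
have C2_ge0 : (0 <= C2)%R.
  rewrite !mulr_ge0 ?powR_ge0// invr_ge0 subr_ge0 ltW//.
  by have /andP[] := powR_itv01 (introT andP (conj w0 w1)) q_gt0.
exists (2 + C1 + C2)%R; first lra.
move=> mu lambda eps a x0 l lambda0 eps0 l0 xx0 Tx0.
(* If the good-lambda set meets the cube, any common point [x1] supplies the growth bound that
   controls the exceptional set; otherwise the empty set serves. *)
have [/set0P[x1 [[Tx1 Mx1] x1a]]|] :=
    boolP (good_lambda_set mu (2 + C1 + C2) eps lambda `&` box a (l / 2) != set0);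
  last first.
  move=> /negPn/eqP->; exists set0; split => //.
  by rewrite measure0 lee_fin mulr_ge0 ?exprn_ge0 ?ltW.
pose K := ((eps * lambda) `^ q^-1)%R.
have el0 : (0 < eps * lambda)%R by rewrite mulr_gt0.
have K0 : (0 < K)%R by rewrite powR_gt0.
have Kq : (K `^ q = eps * lambda)%R by rewrite -powRrM mulVf ?gt_eqF// powRr1// ltW.
have Kmu x : M_frac alpha mu x `^ q <= (eps * lambda)%:E ->
    forall r, (0 < r)%R -> mu (eball x r) <= (K * r `^ (n%:R - alpha))%:E.
  by rewrite -Kq => Mx; apply: M_frac_le Mx => //; exact: ltW.
pose rho := (9 * n%:R * l)%R.
have lr : (l <= rho)%R.
  rewrite /rho ler_peMl ?(ltW l0)//.
  have : (1 <= n%:R :> R)%R by rewrite ler1n.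
  lra.
have rho0 : (0 < rho)%R := lt_le_trans l0 lr.
have [Bad [mBad Badle offBad]] := @small_balls_off_bad_set R n alpha n_gt0 alpha_gt0
  mu a x1 l rho H K (introT andP (conj l0 lr)) H0 K0 x1a (Kmu _ Mx1).
exists (Bad `&` box a (l / 2)); split.
- by apply: measurableI => //; exact: measurable_box.
- by move=> ? [].
- apply: (@le_trans _ _ (borel_lebesgue R n Bad)).
    by apply: le_measure; rewrite ?inE//; apply: measurableI => //; exact: measurable_box.
  apply: (le_trans Badle); rewrite lee_fin le_eqVlt; apply/orP; left; apply/eqP.
  have w10 : (1 - w != 0)%R by rewrite gt_eqF// subr_gt0.
  have d0 : (delta != 0)%R by rewrite gt_eqF.
  rewrite -/w /H /rho exprMn.
  have -> : (C3 / delta = 4 ^+ n * (4 * n%:R) `^ (n%:R - alpha) / (1 - w)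
             / (delta / (9 * n%:R) ^+ n))%R.
    by rewrite /C3 invf_div !mulrA.
  have A9 : ((9 * n%:R) ^+ n != 0 :> R)%R by rewrite gt_eqF// exprn_gt0// mulr_gt0.
  have A0 : (4 ^+ n * (4 * n%:R) `^ (n%:R - alpha) / (1 - w) != 0)%R.
    by rewrite gt_eqF// !mulr_gt0 ?exprn_gt0 ?powR_gt0 ?invr_gt0 ?subr_gt0// mulr_gt0.
  move: (4 ^+ n * _ / _)%R ((9 * n%:R) ^+ n)%R (l ^+ n)%R A9 A0 => A B L B0 A0.
  by field; rewrite d0 A0 B0.
move=> x [[Tx Mx] xa]; split => //; apply: contrapT => xBad.
move: Tx; rewrite ltNge => /negP; apply.
rewrite (T_potE alpha q_gt0).
rewrite (_ : `]0%R, +oo[%classic = `]0%R, rho] `|` `]rho, +oo[ :> set R); last first.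
  by rewrite -itv_bndbnd_setU// bnd_simp ltW.
rewrite ge0_integral_setU//; last 3 first.
- by apply: measurable_density => //; apply: measurableU => //; exact: measurable_itv.
- by move=> r _; exact: density_ge0.
- rewrite disj_set2E; apply/eqP/seteqP; split => // r [].
  by rewrite /= !in_itv/= andbT => /andP[_]; rewrite leNgt => /negP.
apply: (@le_trans _ _ ((C2 * K `^ q)%:E + (lambda%:E + (C1 * K `^ q)%:E))).
  apply: leeD.
    apply: (T_pot_local_le alpha_gt0 alpha_ltn q_gt0 rho0 (ltW H0) (ltW K0)) => // j.
    exact: offBad.
  apply: (le_trans (HC1 mu x x0 rho K rho0 (ltW K0) (xx0 _ xa) (Kmu _ Mx))).
  by rewrite leeD2r.
rewrite -!EFinD lee_fin Kq -subr_ge0.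
rewrite [X in (0 <= X)%R](_ : _ = 2 * (eps * lambda))%R; last by ring.
by rewrite mulr_ge0// ltW.
Qed.

End good_lambda_cube.

(** * Whitney covering *)

Lemma int_threshold (P : int -> Prop) (k0 k1 : int) : ~ P k0 -> P k1 ->
  (forall k l : int, (k <= l)%R -> P k -> P l) ->
  exists k, ~ P k /\ P (k + 1)%R.
Proof.
move=> Pk0 Pk1 Pm.
have k01 : (k0 <= k1)%R by rewrite leNgt; apply/negP => /ltW k10; exact: Pk0 (Pm _ _ k10 Pk1).
have ex : exists j : nat, `[< P (k0 + j%:Z)%R >].
  by exists `|k1 - k0|%N; apply/asboolP; rewrite gez0_abs ?subr_ge0// subrKC.
have [[|j] /asboolP Pj jmin] := ex_minnP ex.
  by exfalso; apply: Pk0; rewrite addr0 in Pj.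
exists (k0 + j%:Z)%R; split.
  by move=> /asboolP/jmin; rewrite ltnn.
by rewrite -addrA -[(j%:Z + 1)%R]/((j%:Z + 1%:Z)%R) -PoszD addn1.
Qed.

Lemma exp2z_ge (R : realType) (r : R) : exists k : int, (r <= 2 ^ k)%R.
Proof.
exists (Num.truncn r).+1%:Z; rewrite -exprnP.
apply: (le_trans (ltW (Num.Theory.truncnS_gt r))).
by rewrite -natrX ler_nat ltnW// ltn_expl.
Qed.

Lemma exp2z_le (R : realType) (r : R) : (0 < r)%R -> exists k : int, (2 ^ k <= r)%R.
Proof.
move=> r0; have [k rk] := exp2z_ge r^-1.
exists (- k)%R; rewrite -invr_expz -[leRHS]invrK lef_pV2 ?posrE ?invr_gt0//.
exact: exprz_gt0.
Qed.

Section whitney.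
Context (R : realType) (n : nat).
Local Notation E := (euclid R n).
Variable Om : set E.
Hypothesis Om_open : forall x, Om x ->
  exists2 r : R, (0 < r)%R & box x r `<=` Om.
Hypothesis Om_proper : exists y, ~ Om y.

(** A witness form of: the sup-norm distance from [x] to the complement of [Om] is at most [r]. No
    infimum is formed. *)
Let near_compl x (r : R) := exists2 y, ~ Om y & box x r y.

Let near_compl_le x y (r s : R) : box x s y -> near_compl x r -> near_compl y (r + s).
Proof.
move=> xy [z Omz xz]; exists z => // i; move: (xy i) (xz i).
rewrite !ler_norml => /andP[? ?] /andP[? ?]; apply/andP; split; lra.
Qed.

Let near_compl_mono x (r s : R) : (r <= s)%R -> near_compl x r -> near_compl x s.
Proof. by move=> rs [z Omz xz]; exists z => // i; exact: le_trans (xz i) rs. Qed.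

Local Notation side k := (2 ^ (k : int) : R)%R.

Let side_gt0 (k : int) : (0 < side k)%R. Proof. exact: exprz_gt0. Qed.

Let sideS (k : int) : side (k + 1) = (2 * side k)%R.
Proof. by rewrite expfzDr// expr1z mulrC. Qed.

Let side_le (k l : int) : (k <= l)%R -> (side k <= side l)%R.
Proof. by move=> kl; rewrite ler_weXz2l// ler1n. Qed.

(* No maximality is required: all cubes of side [s] meeting the layer
   [4 s < dist(y, complement of Om) <= 8 s] are kept; two scales whose layers
   interact differ by a factor at most 2, so parity separates them. *)
Definition whitney_cube : set (int * n.-tuple int) :=
  [set p | exists y, [/\ box (grid_point (side p.1) p.2) (side p.1 / 2) y,
    near_compl y (8 * side p.1) & ~ near_compl y (4 * side p.1)]].

(** Residues modulo 3 suffice within one scale: closed doubles of cubes two steps apart may touch,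
    three steps apart they are disjoint. *)
Definition whitney_color (p : int * n.-tuple int) : bool * n.-tuple 'I_3 :=
  ((p.1 %% 2%:Z)%Z == 0%R, residue 2 p.2).

(** The complement is farther than [4 * side k] for small [k] since [Om] is open, and nearer for
    large [k] since [Om] is proper. At the threshold, [4 * side (k + 1)] equals [8 * side k], as the
    layer requires. *)
Lemma whitney_cover x : Om x ->
  exists2 p, whitney_cube p & box (grid_point (side p.1) p.2) (side p.1 / 2) x.
Proof.
move=> Omx; have [r r0 xr] := Om_open Omx.
have [y0 Omy0] := Om_proper.
have [k0 k0r] : exists k, (side k <= r / 4)%R by apply: exp2z_le; rewrite divr_gt0.
have [k1 k1r] := exp2z_ge (eucl_dist x y0).
have P0 : ~ near_compl x (4 * side k0).
  move=> [z Omz xz]; apply: Omz; apply: xr => i; apply: le_trans (xz i) _.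
  by move: k0r; rewrite ler_pdivlMr// mulrC.
have P1 : near_compl x (4 * side k1).
  exists y0 => // i; apply: le_trans (ler_coord_eucl_dist _ _ _) _.
  apply: (le_trans k1r).
  by have := side_gt0 k1; lra.
have [k [Pk PSk]] := int_threshold P0 P1
  (fun k l kl => near_compl_mono (ler_wpM2l (ler0n R 4) (side_le kl))).
have [m xm] := grid_cover x (side_gt0 k).
exists (k, m) => //; exists x; split => //=.
by apply: near_compl_mono PSk; rewrite sideS; lra.
Qed.

(** Crossing the cube costs one side and reaching the complement eight; the factor [n] passes from
    the sup norm to the Euclidean norm. *)
Lemma whitney_near p : (0 < n)%N -> whitney_cube p -> exists2 x0, ~ Om x0 &
  forall x, box (grid_point (side p.1) p.2) (side p.1 / 2) x ->
    (eucl_dist x x0 <= 9 * n%:R * side p.1)%R.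
Proof.
move=> n_gt0 [y [yp [z Omz yz] _]]; exists z => // x xp.
rewrite (mulrC 9%:R) -mulrA; apply: eucl_dist_le_sup => // i.
move: (yp i) (yz i) (xp i); set g := tcoord (grid_point _ _) i.
rewrite !ler_norml => /andP[? ?] /andP[? ?] /andP[? ?]; apply/andP; split; lra.
Qed.

(** A point of the double is within [3/2] sides of the point [y] in the layer, and [8 + 3/2 = 19/2],
    [4 - 3/2 = 5/2]. *)
Let double_near p z : whitney_cube p -> box (grid_point (side p.1) p.2) (side p.1) z ->
  near_compl z (19 / 2 * side p.1) /\ ~ near_compl z (5 / 2 * side p.1).
Proof.
move=> [y [yp near8 near4]] zp.
have yz : box y (3 / 2 * side p.1) z.
  move=> i; move: (yp i) (zp i); set g := tcoord (grid_point _ _) i.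
  rewrite !ler_norml => /andP[? ?] /andP[? ?]; apply/andP; split; lra.
have zy : box z (3 / 2 * side p.1) y by move=> i; rewrite distrC; exact: yz.
split; first by apply: near_compl_mono (near_compl_le yz near8); lra.
by move=> /(near_compl_le zy) h; apply: near4; apply: near_compl_mono h; lra.
Qed.

Lemma whitney_double p : whitney_cube p ->
  box (grid_point (side p.1) p.2) (side p.1) `<=` Om.
Proof.
move=> Wp z zp; have [_ h] := double_near Wp zp.
apply: contrapT => Omz; apply: h; exists z => // i.
by rewrite subrr normr0 mulr_ge0// ltW.
Qed.

(** If one scale exceeded the other by two or more, the larger cube would give distance above
    [5/2 * 4 = 10] small sides and the smaller one at most [19/2]. So the scales differ by at most
    one, parity makes them equal, and the residues finish. *)
Lemma whitney_disjoint p p' z : whitney_cube p -> whitney_cube p' ->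
  whitney_color p = whitney_color p' ->
  box (grid_point (side p.1) p.2) (side p.1) z ->
  box (grid_point (side p'.1) p'.2) (side p'.1) z -> p = p'.
Proof.
move=> Wp Wp' col zp zp'.
have cp : ((p.1 %% 2%:Z)%Z == 0%R) = ((p'.1 %% 2%:Z)%Z == 0%R) := congr1 fst col.
have {col} cm : residue 2 p.2 = residue 2 p'.2 := congr1 snd col.
have aux a b : whitney_cube a -> whitney_cube b ->
    box (grid_point (side a.1) a.2) (side a.1) z ->
    box (grid_point (side b.1) b.2) (side b.1) z -> ~ (a.1 + 2 <= b.1)%R.
  move=> Wa Wb za zb ab; have [h _] := double_near Wa za.
  have [_] := double_near Wb zb; apply; apply: near_compl_mono h.
  have := side_le ab; rewrite (_ : (a.1 + 2 = a.1 + 1 + 1)%R); last by ring.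
  by rewrite !sideS; have := side_gt0 a.1; lra.
have := aux _ _ Wp Wp' zp zp'; have := aux _ _ Wp' Wp zp' zp => h1 h2.
have e1 : p.1 = p'.1.
  move: h1 h2 cp => /negP h1 /negP h2 cp; lia.
case: p p' e1 {Wp Wp' cp aux h1 h2} cm zp zp' => [k m] [k' m'] /= <- => cm zp zp'.
congr (_, _); apply: (grid_box_inj (side_gt0 k) _ cm zp zp').
by have := side_gt0 k; lra.
Qed.

End whitney.

(** * Weak A_infty weights *)

Section weak_A_infty_weight.
Context (R : realType) (n : nat) (C_sigma theta : R).
Hypothesis n_gt0 : (0 < n)%N.
Variable sigma : leb_euclid R n -> R.
Hypothesis sigmaA : weak_A_infty C_sigma theta sigma.

Lemma weak_A_infty_le (a : leb_euclid R n) (l delta : R) (A : set (leb_euclid R n)) :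
  (0 < l)%R -> (0 <= delta)%R -> measurable A -> A `<=` cube a l ->
  lebesgue A <= (delta * l ^+ n)%:E ->
  weighted sigma A <= (C_sigma * delta `^ theta)%:E * weighted sigma (cube a (2 * l)%R).
Proof.
have [C0 th0 msigma sigma0 HA] := sigmaA.
move=> l0 d0 mA Acube Adelta; apply: (le_trans (HA a l A l0 mA Acube)).
apply: lee_wpmul2r; first by apply: integral_ge0 => x _; rewrite lee_fin.
rewrite EFinM; apply: lee_wpmul2l; first by rewrite lee_fin ltW.
rewrite -poweR_EFin; have ln : (0 < l ^+ n)%R by rewrite exprn_gt0.
rewrite (lebesgue_cube a (ltW l0)) inver gt_eqF//.
apply: le_poweR; first exact: ltW.
  by rewrite mule_ge0// lee_fin invr_ge0 ltW.
apply: (le_trans (lee_wpmul2r _ Adelta)); first by rewrite lee_fin invr_ge0 ltW.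
by rewrite -EFinM mulfK// gt_eqF.
Qed.

(** If the total mass [M] is finite, a fixed cube is a fraction [v^n <= v] of a concentric cube
    whose side is [1/v] times larger. Its weight is then at most [C_sigma v^theta M], which tends to
    0 with [v]; such cubes exhaust the space. *)
Lemma weak_A_infty_total : weighted sigma setT = 0 \/ weighted sigma setT = +oo.
Proof.
have [C0 th0 msigma sigma0 HA] := sigmaA.
have T0 : 0 <= weighted sigma setT by apply: integral_ge0 => x _; rewrite lee_fin.
case ET : (weighted sigma setT) T0 => [M| |//]; last by right.
rewrite lee_fin => M0; left.
pose o : leb_euclid R n := [tuple (0%R : R) | i < n].
have cube0 N : weighted sigma (cube o N.+1%:R) = 0.
  apply/eqP; rewrite eq_le; apply/andP; split; last first.
    by apply: integral_ge0 => x _; rewrite lee_fin.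
  apply/lee_addgt0Pr => e e0; rewrite add0e.
  (* Adding 1 keeps [D] positive when [M = 0]. *)
  pose D := (C_sigma * (M + 1))%R.
  have D0 : (0 < D)%R by rewrite mulr_gt0// ltr_wpDl.
  pose v := Num.min 1%R ((e / D) `^ theta^-1)%R.
  have v0 : (0 < v)%R by rewrite lt_min ltr01 powR_gt0// divr_gt0.
  have v1 : (v <= 1)%R by rewrite ge_min lexx.
  have vD : (D * v `^ theta <= e)%R.
    have vh : (v <= (e / D) `^ theta^-1)%R by rewrite ge_min lexx orbT.
    rewrite mulrC -ler_pdivlMr//.
    apply: le_trans (ge0_ler_powR (ltW th0) _ _ vh) _.
    - by rewrite nnegrE ltW.
    - by rewrite nnegrE powR_ge0.
    - by rewrite -powRrM mulVf ?gt_eqF// powRr1// divr_ge0// ltW.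
  have L0 : (0 < N.+1%:R / v :> R)%R by rewrite divr_gt0.
  apply: (le_trans (@weak_A_infty_le o (N.+1%:R / v) v _ L0 (ltW v0) _ _ _)).
  - by apply: measurable_leb; exact: measurable_box.
  - move=> x xN i; apply: le_trans (xN i) _.
    by rewrite ler_pM2r// ler_pdivlMr// ler_piMr.
  - rewrite lebesgue_cube// lee_fin exprMn.
    rewrite mulrCA exprVn ler_peMr ?exprn_ge0// ler_pdivlMr ?exprn_gt0// mul1r.
    by rewrite ler_iXnr// ltW.
  apply: (@le_trans _ _ ((C_sigma * v `^ theta)%:E * M%:E)).
    apply: lee_wpmul2l; first by rewrite lee_fin mulr_ge0 ?powR_ge0 ?ltW.
    rewrite -ET; apply: le_integral_set => // x; by rewrite lee_fin.
  rewrite -EFinM lee_fin; apply: le_trans vD.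
  rewrite /D mulrAC ler_wpM2r ?powR_ge0// ler_wpM2l ?ltW//.
  by rewrite ltr_pwDr.
have mcube N : measurable (cube o N.+1%:R).
  by apply: measurable_leb; exact: measurable_box.
rewrite -ET; apply/eqP; rewrite eq_le; apply/andP; split; last by rewrite ET lee_fin.
apply: (@le_trans _ _ (\sum_(0 <= N <oo) weighted sigma (cube o N.+1%:R))).
  apply: (measure_sigma_subadditive (weighted_measure msigma sigma0)) => //.
  move=> x _; exists (Num.truncn (2 * \sum_i `|tcoord x i|)%R) => // i.
  rewrite /o tnth_mktuple subr0 ler_pdivlMr// mulrC.
  apply: le_trans (ltW (Num.Theory.truncnS_gt _)).
  rewrite ler_pM2l//; rewrite (bigD1 i)//= lerDl; exact: sumr_ge0.
by rewrite (eq_eseriesr (fun N _ => cube0 N)) eseries0.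
Qed.

End weak_A_infty_weight.

(** * Summation over the Whitney cubes *)

Unset Implicit Arguments.
Local Close Scope ereal_scope.

Theorem theorem1p3 (R : realType) (n : nat) (alpha q C_sigma theta : R)
    (n_ge1 : (1 <= n)%N) (alpha_gt0 : 0 < alpha) (alpha_ltn : alpha < n%:R)
    (q_gt0 : 0 < q) :
  exists c C : R, [/\ 1 < c, 0 < C, C < 1 &
    forall (sigma : leb_euclid R n -> R),
      weak_A_infty C_sigma theta sigma ->
    forall (mu : {measure set (euclid R n) -> \bar R}) (lambda epsilon : R),
      0 < lambda -> 0 < epsilon -> epsilon < 1 ->
      (weighted sigma
         [set x | ((1 + c * epsilon) * lambda)%:E < T_pot alpha q mu x `^ q
                  /\ M_frac alpha mu x `^ q <= (epsilon * lambda)%:E]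
       <= C%:E * weighted sigma
                   [set x | lambda%:E < T_pot alpha q mu x `^ q])%E].
Proof.
(* The constants are chosen before [sigma]; for nonpositive [C_sigma] or [theta] there is no such
   weight and any admissible constants serve. *)
have [C0|C0] := ltP 0 C_sigma; last first.
  exists 2, 2^-1; split; rewrite ?ltr1n ?invr_gt0 ?invf_lt1 ?ltr1n// => sigma [C0'].
  by move: C0; rewrite leNgt C0'.
have [th0|th0] := ltP 0 theta; last first.
  exists 2, 2^-1; split; rewrite ?ltr1n ?invr_gt0 ?invf_lt1 ?ltr1n// => sigma [_ th0'].
  by move: th0; rewrite leNgt th0'.
(* The number of Whitney colors; [delta] is chosen so that the losses over all colors add up to the
   factor [1/2]. *)
pose N : R := (2 * 3 ^ n)%N%:R.
have N0 : 0 < N by rewrite ltr0n muln_gt0 expn_gt0.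
pose delta := (2^-1 / (N * C_sigma)) `^ theta^-1.
have d0 : 0 < delta by rewrite powR_gt0// divr_gt0 ?invr_gt0 ?mulr_gt0.
have deltaE : N * (C_sigma * delta `^ theta) = 2^-1.
  have X0 : 0 <= 2^-1 / (N * C_sigma) by rewrite divr_ge0 ?invr_ge0// mulr_ge0// ltW.
  rewrite /delta -powRrM mulVf ?gt_eqF// powRr1//.
  by field; rewrite !gt_eqF.
have [c c1 cubeP] := good_lambda_in_cube n_ge1 alpha_gt0 alpha_ltn q_gt0 d0.
exists c, 2^-1; split; rewrite ?ltr1n ?invr_gt0 ?invf_lt1 ?ltr1n// => sigma sigmaA.
move=> mu lambda epsilon l0 e0 e1.
have [_ _ msigma sigma0 _] := sigmaA.
have weighted_ge0 A : (0 <= weighted sigma A)%E.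
  by apply: integral_ge0 => x _; rewrite lee_fin.
pose Om : set (euclid R n) := [set x | (lambda%:E < T_pot alpha q mu x `^ q)%E].
rewrite -[X in weighted sigma X]/(good_lambda_set alpha q mu c epsilon lambda).
rewrite -[X in (_ <= _ * weighted sigma X)%E]/Om.
(* With no complement there are no Whitney cubes, but the right-hand side is then half of a total
   mass that is 0 or infinite. *)
have [OmT|/existsNP Om_proper] := pselect (forall x, Om x).
  have -> : Om = setT by apply/seteqP; split.
  have : (weighted sigma (good_lambda_set alpha q mu c epsilon lambda) <=
          weighted sigma setT)%E by exact: le_weighted.
  have [->|->] := weak_A_infty_total n_ge1 sigmaA; first by rewrite mule0.
  by rewrite gt0_muley ?lte_fin ?invr_gt0// leey.
have nR0 : 0 < n%:R :> R by rewrite ltr0n.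
have Om_open x : Om x -> exists2 r : R, 0 < r & box x r `<=` Om.
  move=> Omx; have [d dgt0 xd] := T_pot_gt_open alpha_ltn q_gt0 l0 Omx.
  exists (d / n%:R); first by rewrite divr_gt0.
  move=> y xy; apply: xd.
  by rewrite (le_trans (eucl_dist_le_sup n_ge1 xy))// mulrC divfK// gt_eqF.
pose W := whitney_cube Om.
pose Q (p : int * n.-tuple int) := box (grid_point (2 ^ p.1 : R) p.2) (2 ^ p.1 / 2).
pose Q2 (p : int * n.-tuple int) := box (grid_point (2 ^ p.1 : R) p.2) (2 ^ p.1).
have side_gt0 (k : int) : 0 < 2 ^ k :> R by exact: exprz_gt0.
have /choice[Bad BadP] : forall p, exists B : set (euclid R n), W p ->
    [/\ measurable B, B `<=` Q p,
      (borel_lebesgue R n B <= (delta * (2 ^ p.1) ^+ n)%:E)%E &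
      good_lambda_set alpha q mu c epsilon lambda `&` Q p `<=` B].
  move=> p; have [Wp|] := pselect (W p); last by exists set0.
  have [x0 Omx0 Qx0] := whitney_near n_ge1 Wp.
  have Tx0 : (T_pot alpha q mu x0 `^ q <= lambda%:E)%E.
    by rewrite leNgt; apply/negP.
  have [B ?] := cubeP mu lambda epsilon _ x0 _ l0 e0 (side_gt0 p.1) Qx0 Tx0.
  by exists B.
pose sig := weighted_measure msigma sigma0.
have cover : good_lambda_set alpha q mu c epsilon lambda `<=` \bigcup_(p in W) Bad p.
  move=> x gx; have Omx : Om x.
    case: gx => Tx _; apply: le_lt_trans Tx; rewrite lee_fin ler_peMl ?ltW//.
    by rewrite ltrDl mulr_gt0// (lt_trans _ c1).
  have [p Wp xp] := whitney_cover Om_open Om_proper Omx.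
  by exists p => //; have [_ _ _] := BadP p Wp; apply.
have mQ2 p : measurable (Q2 p : set (leb_euclid R n)).
  by apply: measurable_leb; exact: measurable_box.
apply: (le_trans (le_weighted sigma0 cover)).
pose U : set (leb_euclid R n) := \bigcup_(p in W) Q2 p.
have UOm : U `<=` Om by move=> x [p Wp] xp; exact: (whitney_double Wp xp).
apply: (@le_trans _ _ (2^-1%:E * weighted sigma U)%E); last first.
  by apply: lee_wpmul2l; [rewrite lee_fin|exact: le_weighted].
(* Both measures are now the [sigma]-measure: each exceptional set is compared with the double of
   its Whitney cube. *)
have := @colored_family_le R _ _ _ (leb_euclid R n) (leb_euclid R n) sig sig _
  (@whitney_color n) W Bad Q2 U (C_sigma * delta `^ theta).
rewrite card_prod card_bool card_tuple card_ord -/N deltaE; apply => //.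
- by rewrite mulr_ge0 ?powR_ge0 ?ltW.
- by move=> p /BadP[mB _ _ _]; exact: measurable_leb.
- move=> p p' Wp Wp' col [z [zp zp']].
exact: (whitney_disjoint Wp Wp' col zp zp').
- move=> p /BadP[mB BQ Bdelta _].
  have := @weak_A_infty_le R n C_sigma theta sigma sigmaA
    (grid_point (2 ^ p.1 : R) p.2) (2 ^ p.1) delta (Bad p) (side_gt0 _) (ltW d0)
    (measurable_leb mB) BQ.
  rewrite lebesgueE// => /(_ Bdelta).
  rewrite (_ : cube _ _ = Q2 p)//.
  (* The double has side [2 * 2 ^ p.1], hence half-side [2 ^ p.1]. *)
  have E : 2 * 2 ^ p.1 / 2 = 2 ^ p.1 :> R by rewrite mulrAC mulfV ?mul1r.
  by rewrite /Q2 -[X in box _ X]E.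
- by apply: countable_bigcup_measurable.
- by move=> p Wp x xp; exists p.
Qed.
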